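(* Let $\mathfrak{M}$ be the class of all $2^{k-1}$ normal linear submodels (containing the intercept) of a normal linear model with $k$ regressors, $k$ fixed, and let $M_T\in\mathfrak{M}$ be the true model, with fixed parameters $\boldsymbol\alpha_T,\sigma_T>0$; that is, for each $n$ the data satisfy $\mathbf{y}\sim\mathrm{N}_n(\mathbf{X}_T\boldsymbol\alpha_T,\sigma_T^2\mathbf{I}_n)$. Assume the design matrices satisfy condition (D): for every $M_j\in\mathfrak{M}$ the limit $$\mathbf{S}_{jT}=\lim_{n\to\infty}\frac{\mathbf{X}_T'(\mathbf{I}-\mathbf{H}_j)\mathbf{X}_T}{n}$$ exists and is a positive semidefinite matrix, with $\boldsymbol\alpha_T'\mathbf{S}_{jT}\boldsymbol\alpha_T>0$ whenever $M_j\ne M_T$ and $M_T$ is not nested in $M_j$. Then the intrinsic Bayesian variable selection procedure from below (VSB) is consistent: for every $M_j\in\mathfrak{M}$ with $M_j\neq M_T$, when sampling from $M_T$, $$\frac{P(M_j|\mathbf{y},\mathbf{X})}{P(M_T|\mathbf{y},\mathbf{X})}\to 0\quad\text{in probability as } n\to\infty,$$ where $P(\cdot|\mathbf{y},\mathbf{X})$ are the intrinsic posterior model probabilities from below $$P(M_j|\mathbf{y},\mathbf{X})=\frac{BF_{j1}}{1+\sum_{M_{j'}\in\mathfrak{M},\,M_{j'}\neq M_1}BF_{j'1}},\qquad M_j\in\mathfrak{M}.$$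
   Context: Setting. For each sample size $n>k$ there is an $n\times k$ design matrix $\mathbf{X}$ of full column rank whose first column is the vector of ones. Each model in $\mathfrak{M}$ corresponds to a subset of the columns of $\mathbf{X}$ that contains the first column (the subset does not depend on $n$). The symbol $M_j$ denotes any model with $j$ regressors (there may be several with the same $j$); $\mathbf{X}_j$ is the corresponding $n\times j$ submatrix of $\mathbf{X}$, and $\mathbf{H}_j=\mathbf{X}_j(\mathbf{X}_j'\mathbf{X}_j)^{-1}\mathbf{X}_j'$. Under $M_j$, $\mathbf{y}\sim\mathrm{N}_n(\mathbf{X}_j\boldsymbol\alpha_j,\sigma_j^2\mathbf{I}_n)$. $M_1$ is the model containing only the intercept. A model is nested in another if its set of columns is contained in the other's. $T$ also denotes the number of regressors of $M_T$. Bayes factors. If $M_i$ is nested in $M_j$ with $i<j$, let $\mathcal{B}_{ij}^n=\mathbf{y}'(\mathbf{I}-\mathbf{H}_j)\mathbf{y}/\mathbf{y}'(\mathbf{I}-\mathbf{H}_i)\mathbf{y}$. The Bayes factor of $M_i$ versus $M_j$ for intrinsic priors is $$BF_{ij}^n=\left(\frac{2}{\pi}(j+1)^{(j-i)/2}\int_0^{\pi/2}\frac{\sin^{j-i}\varphi\,(n+(j+1)\sin^2\varphi)^{(n-j)/2}}{(n\mathcal{B}_{ij}^n+(j+1)\sin^2\varphi)^{(n-i)/2}}\,d\varphi\right)^{-1}.$$ (It arises from the prior $\pi^N(\boldsymbol\alpha_i,\sigma_i)=c_i/\sigma_i$ on $M_i$ and on $M_j$ the intrinsic prior $\int\pi^I(\boldsymbol\beta_j,\sigma_j|\boldsymbol\alpha_i,\sigma_i)\pi^N(\boldsymbol\alpha_i,\sigma_i)\,d\boldsymbol\alpha_i\,d\sigma_i$,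 where $\pi^I(\boldsymbol\beta_j,\sigma_j|\boldsymbol\alpha_i,\sigma_i)=\frac{2}{\pi\sigma_i(1+\sigma_j^2/\sigma_i^2)}\mathrm{N}_j\big(\boldsymbol\beta_j|\tilde{\boldsymbol\alpha}_j,(\sigma_j^2+\sigma_i^2)\frac{n}{j+1}(\mathbf{X}_j'\mathbf{X}_j)^{-1}\big)$ and $\tilde{\boldsymbol\alpha}_j$ is $\boldsymbol\alpha_i$ padded with $j-i$ zeros; the displayed closed form may be taken as the definition.) For the comparison with $M_1$, $BF_{j1}=1/BF_{1j}^n$ for $M_j\neq M_1$, and $BF_{11}=1$. *)

(* Defs.v *)
(* MathComp-Analysis *)
From HB Require Import structures.
From mathcomp Require Import all_boot all_order all_algebra.
From mathcomp Require Import all_classical all_reals all_analysis.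
Set Implicit Arguments.
Unset Strict Implicit.
Unset Printing Implicit Defensive.
Import Order.TTheory GRing.Theory Num.Theory.
Import numFieldNormedType.Exports.
Local Open Scope classical_set_scope.
Local Open Scope ring_scope.

(* There are k = p.+1 >= 1 regressors, indexed by 'I_p.+1, and ord0 is the
   intercept; a model is identified with its set of columns, the number of
   regressors of M being #|M|, and nesting being inclusion. *)
Definition models (p : nat) : {set {set 'I_p.+1}} :=
  [set M : {set 'I_p.+1} | ord0 \in M].

Definition null_model (p : nat) : {set 'I_p.+1} := [set ord0].

Section LinearModels.
Context {R : realType} {p : nat}.
Implicit Types (M Mi Mj : {set 'I_p.+1}).

Definition design_matrix n (X : 'M[R]_(n, p.+1)) : Prop :=
  \rank X = p.+1 /\ forall i, X i ord0 = 1.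

Definition submatrix n (X : 'M[R]_(n, p.+1)) M : 'M[R]_(n, #|M|) :=
  colsub (fun c : 'I_#|M| => enum_val c) X.

Definition hat n (X : 'M[R]_(n, p.+1)) M : 'M[R]_n :=
  let XM := submatrix X M in XM *m invmx (XM^T *m XM) *m XM^T.

Definition qform m (A : 'M[R]_m) (v : 'cV[R]_m) : R := (v^T *m A *m v) 0 0.

Definition psd m (A : 'M[R]_m) : Prop :=
  A^T = A /\ forall v, 0 <= qform A v.

Definition condition_D (X : forall n, 'M[R]_(n, p.+1)) (T : {set 'I_p.+1})
    (alpha : 'cV[R]_#|T|) : Prop :=
  forall M, M \in models p ->
    exists S : 'M[R]_#|T|,
      [/\ (n%:R^-1 *: ((submatrix (X n) T)^T *m (1%:M - hat (X n) M)
                        *m submatrix (X n) T)) @[n --> \oo] --> S,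
          psd S
        & M != T -> ~~ (T \subset M) -> 0 < qform S alpha].

Definition rss_ratio n (X : 'M[R]_(n, p.+1)) (y : 'cV[R]_n) Mi Mj : R :=
  qform (1%:M - hat X Mj) y / qform (1%:M - hat X Mi) y.

(* Bayes factor of Mi versus Mj for intrinsic priors; meaningful when Mi is a
   proper subset of Mj and p.+1 < n. *)
Definition bayes_factor n (X : 'M[R]_(n, p.+1)) (y : 'cV[R]_n) Mi Mj : R :=
  let i := #|Mi| in
  let j := #|Mj| in
  let B := rss_ratio X y Mi Mj in
  (2 / pi * j.+1%:R `^ ((j%:R - i%:R) / 2) *
   \int[lebesgue_measure]_(phi in `[0%R, (pi / 2)%R]%classic)
     (sin phi ^+ (j - i)
      * (n%:R + j.+1%:R * sin phi ^+ 2) `^ ((n%:R - j%:R) / 2)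
      / (n%:R * B + j.+1%:R * sin phi ^+ 2) `^ ((n%:R - i%:R) / 2)))^-1.

Definition bf_vs_null n (X : 'M[R]_(n, p.+1)) (y : 'cV[R]_n) M : R :=
  if M == null_model p then 1 else (bayes_factor X y (null_model p) M)^-1.

Definition posterior n (X : 'M[R]_(n, p.+1)) (y : 'cV[R]_n) M : R :=
  bf_vs_null X y M /
  (1 + \sum_(M' in models p | M' != null_model p) bf_vs_null X y M').

End LinearModels.

(* y ~ N_n(mu, sigma^2 I_n): the joint law of the coordinates is the product
   of the laws N(mu_i, sigma^2), expressed on the measurable boxes, which
   generate the Borel sets of R^n.  The second parameter of normal_prob is
   the standard deviation. *)
Definition spherical_normal {R : realType} {d : measure_display}
    {Omega : measurableType d} (P : probability Omega R) (n : nat)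
    (y : 'I_n -> {RV P >-> R}) (mu : 'cV[R]_n) (sigma : R) : Prop :=
  forall B : 'I_n -> set R, (forall i, measurable (B i)) ->
    P [set w | forall i, B i (y i w)] =
    (\prod_(i < n) normal_prob (mu i 0%R) sigma (B i))%E.

Definition sample {R : realType} {d : measure_display}
    {Omega : measurableType d} (P : probability Omega R) (n : nat)
    (y : 'I_n -> {RV P >-> R}) (w : Omega) : 'cV[R]_n :=
  \col_i y i w.

(* Each Z n may live on its own probability space. *)
Definition cvg_in_probability {R : realType} {d : nat -> measure_display}
    {Omega : forall n, measurableType (d n)}
    (P : forall n, probability (Omega n) R)
    (Z : forall n, Omega n -> R) (l : R) : Prop :=
  forall eps : R, 0 < eps ->
    P n [set w | eps < `|Z n w - l|] @[n --> \oo] --> 0%E.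

(* Main.v *)
Require Import Defs.
From mathcomp Require Import all_boot all_order all_algebra.
From mathcomp Require Import all_classical all_reals all_analysis.
From mathcomp Require Import measurable_realfun ring lra.
Set Implicit Arguments.
Unset Strict Implicit.
Unset Printing Implicit Defensive.
Import Order.TTheory GRing.Theory Num.Theory.
Import numFieldNormedType.Exports.
Local Open Scope classical_set_scope.
Local Open Scope ring_scope.

(* Let RSS_M be the residual sum of squares of the model M and |M| its number of
   regressors.  Bounding the integrand of the Bayes factor pointwise shows that
   BF_M1 is at most a constant times n^((1-|M|)/2) (RSS_M/RSS_1)^(-(n-1)/2), and
   at least a constant times this as long as RSS_M/RSS_1 stays away from 0.  The
   posterior ratio is thus at most a constant times
     n^((|T|-|M|)/2) (RSS_T/RSS_M)^((n-1)/2).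
   When sampling from T, RSS_M = n (s + alpha' S_MT alpha) + o_P(n), where s is
   the error variance.  If T is not nested in M, the quotient RSS_T/RSS_M is
   eventually below some rho < 1 and the second factor decays exponentially.  If
   T is nested in M, then RSS_T - RSS_M <= |H_M eps|^2 = O_P(1), so the second
   factor stays bounded while the first one tends to 0.  All the deviations are
   controlled at once by Markov's inequality applied to a sum of squares of
   linear forms in the errors, which needs only their moments up to order 4. *)

(** * Projections onto the column space of a submatrix *)

Section hat_matrix.
Context {R : realType}.

Definition dotc n (u v : 'cV[R]_n) : R := \sum_i u i 0 * v i 0.

Lemma dotcE n (u v : 'cV[R]_n) : (u^T *m v) 0 0 = dotc u v.
Proof. by rewrite mxE; apply: eq_bigr => i _; rewrite mxE. Qed.

Lemma dotc_ge0 n (u : 'cV[R]_n) : 0 <= dotc u u.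
Proof. by apply: sumr_ge0 => i _; rewrite -expr2 sqr_ge0. Qed.

Lemma dotc_eq0 n (u : 'cV[R]_n) : (dotc u u == 0) = (u == 0).
Proof.
apply/eqP/eqP => [/eqP|->]; last by apply: big1 => i _; rewrite mxE mul0r.
rewrite psumr_eq0 => [/allP u0|i _]; last by rewrite -expr2 sqr_ge0.
apply/colP => i; rewrite mxE; have := u0 i (mem_index_enum i).
by rewrite /= mulf_eq0 orbb => /eqP.
Qed.

Lemma qform_proj n (A : 'M[R]_n) (u : 'cV[R]_n) :
  A^T = A -> A *m A = A -> qform A u = dotc (A *m u) (A *m u).
Proof.
by move=> At AA; rewrite -dotcE trmx_mul At -mulmxA (mulmxA A A) AA /qform mulmxA.
Qed.

Lemma qformD n (A : 'M[R]_n) (u v : 'cV[R]_n) : A^T = A ->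
  qform A (u + v) = qform A u + 2 * dotc (A *m u) v + qform A v.
Proof.
move=> At; have E w z : (w^T *m A *m z) 0 0 = dotc (A *m w) z.
  by rewrite -dotcE trmx_mul At.
rewrite /qform !E mulmxDr; set Au := A *m u; set Av := A *m v.
have -> : dotc (Au + Av) (u + v)
    = dotc Au u + dotc Au v + dotc Av u + dotc Av v.
  by rewrite /dotc -!big_split/=; apply: eq_bigr => i _; rewrite !mxE; ring.
have -> : dotc Av u = dotc Au v.
  rewrite /Av /Au -!E; transitivity ((v^T *m A *m u)^T 0 0); first by rewrite [RHS]mxE.
  by rewrite !trmx_mul trmxK At mulmxA.
ring.
Qed.

Section fixed_design.
Context {p : nat} {n : nat} (X : 'M[R]_(n, p.+1)) (hX : \rank X = p.+1).
Implicit Types M N : {set 'I_p.+1}.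

(** The 0/1 matrix [E] spreads [v] over the columns in [M]. Since [X] has independent columns,
    [X *m (E *m v) = 0] forces [E *m v = 0], whose entries at the columns of [M] are those of
    [v]. *)
Lemma submatrix_inj M (v : 'cV[R]_#|M|) : submatrix X M *m v = 0 -> v = 0.
Proof.
pose E : 'M[R]_(p.+1, #|M|) := submatrix 1%:M M.
have -> : submatrix X M = X *m E by rewrite /E /submatrix mulmx_colsub mulmx1.
move=> XEv.
have Xfree : row_free X^T by rewrite /row_free mxrank_tr hX.
have Ev : E *m v = 0.
  apply: trmx_inj; apply: (row_free_inj Xfree).
  by rewrite -trmx_mul mulmxA XEv !trmx0 mul0mx.
apply/colP => i; rewrite mxE.
have /colP/(_ (enum_val i)) := Ev; rewrite !mxE (bigD1 i)//= big1 ?addr0.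
  by rewrite !mxE eqxx mul1r.
move=> j ji; rewrite !mxE; case: eqP => [/enum_val_inj ij|_]; last by rewrite mul0r.
by rewrite ij eqxx in ji.
Qed.

(** If [v *m G = 0] then the squared norm of [submatrix X M *m v^T] is [v G v^T = 0], so [v]
    vanishes by [submatrix_inj]. *)
Lemma gram_unitmx M : (submatrix X M)^T *m submatrix X M \in unitmx.
Proof.
set G := _ *m _; rewrite -row_free_unit -kermx_eq0; apply/eqP/row_matrixP => i.
rewrite row0; set v := row i _.
have vG : v *m G = 0 by rewrite -row_mul mulmx_ker row0.
have : submatrix X M *m v^T = 0.
  apply/eqP; rewrite -dotc_eq0 -dotcE trmx_mul trmxK -mulmxA (mulmxA _ _ v^T).
  by rewrite mulmxA vG mul0mx mxE.
by move/submatrix_inj => v0; rewrite -(trmxK v) v0 trmx0.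
Qed.

Lemma hat_submatrix M : hat X M *m submatrix X M = submatrix X M.
Proof. by rewrite /hat -!mulmxA mulVmx ?gram_unitmx// mulmx1. Qed.

Lemma tr_hat M : (hat X M)^T = hat X M.
Proof. by rewrite /hat !trmx_mul trmx_inv !trmx_mul !trmxK mulmxA. Qed.

Lemma hat_idem M : hat X M *m hat X M = hat X M.
Proof. by rewrite {2}/hat !mulmxA hat_submatrix. Qed.

Lemma mxtrace_hat M : \tr (hat X M) = #|M|%:R.
Proof. by rewrite /hat mxtrace_mulC mulmxA mulmxV ?gram_unitmx// mxtrace1. Qed.

Lemma hat_submatrix_sub M N : M \subset N ->
  hat X N *m submatrix X M = submatrix X M.
Proof.
(* [E] selects the columns of [M] among those of [N]. *)
move=> MN; pose E := \matrix_(i < #|N|, j < #|M|)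
  ((enum_val i == enum_val j)%:R : R).
suff -> : submatrix X M = submatrix X N *m E by rewrite mulmxA hat_submatrix.
apply/matrixP => i j; rewrite !mxE.
have jN : enum_val j \in N by exact: (fintype.subsetP MN) _ (enum_valP j).
rewrite (bigD1 (enum_rank_in jN (enum_val j)))//= big1 ?addr0.
  by rewrite !mxE enum_rankK_in// eqxx mulr1.
move=> k kj; rewrite !mxE; case: eqP => [kE|_]; last by rewrite mulr0.
suff kE' : k = enum_rank_in jN (enum_val j) by rewrite kE' eqxx in kj.
by apply: enum_val_inj; rewrite enum_rankK_in.
Qed.

Definition res M : 'M[R]_n := 1%:M - hat X M.

Lemma tr_res M : (res M)^T = res M.
Proof. by rewrite /res linearB /= trmx1 tr_hat. Qed.

Lemma res_idem M : res M *m res M = res M.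
Proof.
by rewrite /res mulmxBl mulmxBr !mul1mx mulmxBr mulmx1 hat_idem subrr subr0.
Qed.

(** The noise part is split as [|eps|^2 - |H eps|^2]: the first term is of order n but common to all
    models, the second is bounded in probability. *)
Lemma qform_res_decomp M (mu eps : 'cV[R]_n) :
  qform (res M) (mu + eps) =
  dotc (res M *m mu) (res M *m mu) + 2 * dotc (res M *m mu) eps
  + dotc eps eps - dotc (hat X M *m eps) (hat X M *m eps).
Proof.
rewrite qformD ?tr_res// [qform _ mu]qform_proj ?tr_res ?res_idem//.
rewrite -[RHS]addrA; congr (_ + _).
have <- := qform_proj eps (tr_hat M) (hat_idem M); rewrite -(dotcE eps eps).
by rewrite /qform /res mulmxBr mulmx1 mulmxBl [LHS]mxE [X in _ + X]mxE addrC.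
Qed.

(** The sum is the trace of [H H^T = H], that is, the rank. As it does not grow with n, neither does
    the mean of [|H eps|^2]. *)
Lemma sum_sqr_hat M : \sum_i \sum_j hat X M i j ^+ 2 = #|M|%:R.
Proof.
rewrite -mxtrace_hat -{2}hat_idem; apply: eq_bigr => i _; rewrite mxE.
apply: eq_bigr => j _; rewrite expr2; congr (_ * _).
by have := congr1 (fun A : 'M[R]_n => A j i) (tr_hat M); rewrite mxE.
Qed.

End fixed_design.

End hat_matrix.

(** * Bounds on the Bayes factors *)

Section bayes_factor_bounds.
Context {R : realType}.

Lemma powR_le (r x y : R) : 0 <= r -> 0 <= x -> x <= y -> x `^ r <= y `^ r.
Proof.
by move=> r0 x0 xy; apply: ge0_ler_powR; rewrite ?nnegrE// (le_trans x0).
Qed.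

(** Factor out [x] and use [1 + u <= expR u] with [u = c / x]. *)
Lemma powR_addr_ub (x c r : R) : 0 < x -> 0 <= c -> 0 <= r ->
  (x + c) `^ r <= x `^ r * expR (r * (c / x)).
Proof.
move=> x0 c0 r0; have cx0 : 0 <= c / x by rewrite divr_ge0// ltW.
have -> : x + c = x * (1 + c / x) by rewrite mulrDr mulr1 mulrC divfK ?gt_eqF.
rewrite powRM ?(ltW x0) ?addr_ge0// ler_pM2l ?powR_gt0//.
rewrite [r * _]mulrC expRM powR_le ?addr_ge0//.
exact: expR_ge1Dx.
Qed.

Lemma powR_div_split (x B r q : R) : 0 < x -> 0 < B ->
  x `^ r / (x * B) `^ q = x `^ (r - q) * B `^ (- q).
Proof.
move=> x0 B0; rewrite powRM ?ltW// invfM mulrA powRN.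
by rewrite powRB// (gt_eqF x0) implybT.
Qed.

Definition bf_integrand (n j : nat) (B phi : R) : R :=
  sin phi ^+ (j - 1)
  * (n%:R + j.+1%:R * sin phi ^+ 2) `^ ((n%:R - j%:R) / 2)
  / (n%:R * B + j.+1%:R * sin phi ^+ 2) `^ ((n%:R - 1%:R) / 2).

(** This is what the two powers in the integrand become when the shifts by [(j+1) sin^2 phi] are
    dropped, with the powers of n collected. *)
Definition bf_rate (n j : nat) (B : R) : R :=
  n%:R `^ ((1 - j%:R) / 2) * B `^ (- ((n%:R - 1) / 2)).

Section pointwise.
Variables (n j : nat) (B phi : R).
Hypotheses (jn : (j < n)%N) (B0 : 0 < B) (s0 : 0 <= sin phi).

Let n0 : 0 < n%:R :> R. Proof. by rewrite ltr0n (leq_trans _ jn). Qed.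
Let n1 : 0 <= (n%:R - 1) / 2 :> R.
Proof. by rewrite divr_ge0// subr_ge0 ler1n (leq_trans _ jn). Qed.
Let nj : 0 <= (n%:R - j%:R) / 2 :> R.
Proof. by rewrite divr_ge0// subr_ge0 ler_nat ltnW. Qed.
Let c0 : 0 <= j.+1%:R * sin phi ^+ 2.
Proof. by rewrite mulr_ge0// exprn_ge0. Qed.
Let c1 : j.+1%:R * sin phi ^+ 2 <= j.+1%:R.
Proof. by rewrite ler_piMr// expr_le1// sin_le1. Qed.

Let rateE : n%:R `^ ((n%:R - j%:R) / 2) / (n%:R * B) `^ ((n%:R - 1) / 2)
  = bf_rate n j B.
Proof. by rewrite powR_div_split// /bf_rate; congr (_ `^ _ * _); field. Qed.

Lemma bf_integrand_ge0 : 0 <= bf_integrand n j B phi.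
Proof. by rewrite divr_ge0 ?mulr_ge0 ?powR_ge0// exprn_ge0. Qed.

(** Dropping the shift in the denominator only enlarges the integrand. The shift in the numerator
    costs at most the exponential of [(n-j)/2 * (j+1)/n <= (j+1)/2], and the power of the sine is at
    most 1. *)
Lemma bf_integrand_ub :
  bf_integrand n j B phi <= expR (j.+1%:R / 2) * bf_rate n j B.
Proof.
rewrite -rateE mulrA /bf_integrand.
apply: ler_pM; rewrite ?invr_ge0 ?powR_ge0 ?mulr_ge0 ?exprn_ge0 ?powR_ge0//; last first.
  rewrite lef_pV2 ?posrE ?powR_gt0 ?mulr_gt0//; last first.
    by rewrite (lt_le_trans (mulr_gt0 n0 B0))// lerDl.
  by apply: powR_le; rewrite ?lerDl// ltW// mulr_gt0.
rewrite (le_trans (y := (n%:R + j.+1%:R * sin phi ^+ 2) `^ ((n%:R - j%:R) / 2)))//.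
  by rewrite ler_piMl ?powR_ge0// exprn_ile1// sin_le1.
rewrite (le_trans (powR_addr_ub n0 c0 nj))// mulrC ler_pM2r ?powR_gt0// ler_expR.
rewrite mulrA ler_pdivrMr// mulrAC [leRHS]mulrAC ler_pM2r ?invr_gt0//.
by rewrite mulrC ler_pM ?gerBl// subr_ge0 ler_nat ltnW.
Qed.

(** Now the shift in the numerator is dropped, and that in the denominator costs at most the
    exponential of [(n-1)/2 * (j+1)/(n B) <= (j+1)/(2 delta)]. This is where [B] has to stay away
    from 0. *)
Lemma bf_integrand_lb (a delta : R) : 0 <= a <= sin phi -> 0 < delta <= B ->
  a ^+ (j - 1) * expR (- (j.+1%:R / (delta *+ 2))) * bf_rate n j B
  <= bf_integrand n j B phi.
Proof.
move=> /andP[a0 a_s] /andP[d0 dB]; have nB : 0 < n%:R * B by exact: mulr_gt0.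
rewrite -rateE /bf_integrand -!mulrA ler_pM ?exprn_ge0 ?mulr_ge0 ?expR_ge0 ?invr_ge0 ?powR_ge0//.
  by rewrite lerXn2r ?nnegrE.
rewrite [leLHS]mulrCA ler_pM ?mulr_ge0 ?expR_ge0 ?invr_ge0 ?powR_ge0//.
  by apply: powR_le; rewrite ?lerDl.
rewrite expRN -invfM lef_pV2 ?posrE ?mulr_gt0 ?expR_gt0 ?powR_gt0//; last first.
  by rewrite (lt_le_trans nB)// lerDl.
rewrite (le_trans (powR_addr_ub nB c0 n1))// mulrC ler_pM2r ?powR_gt0// ler_expR.
have -> : (n%:R - 1) / 2 * (j.+1%:R * sin phi ^+ 2 / (n%:R * B))
    = (n%:R - 1) / n%:R * (j.+1%:R * sin phi ^+ 2 / (B *+ 2)).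
  by field; rewrite !gt_eqF.
rewrite -[leRHS]mul1r ler_pM ?divr_ge0 ?mulrn_wge0 ?(ltW B0) ?(ltW n0)//.
- by rewrite subr_ge0 ler1n (leq_trans _ jn).
- by rewrite ler_pdivrMr// mul1r gerBl.
- rewrite ler_pM ?invr_ge0 ?mulrn_wge0 ?(ltW B0)//.
  by rewrite lef_pV2 ?posrE ?pmulrn_rgt0// lerMn2r.
Qed.

End pointwise.

Lemma measurable_funV d (T : measurableType d) (D : set T) (f : T -> R) :
  measurable D -> measurable_fun D f -> measurable_fun D (fun x => (f x)^-1).
Proof.
(* Squaring makes the base of the real power nonnegative; the identity also holds where [f]
   vanishes, the inverse of 0 being 0. *)
move=> mD mf; have -> : (fun x => (f x)^-1) = (fun x => f x * (f x ^+ 2) `^ (-1)).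
  apply/funext => x; rewrite powR_inv1 ?sqr_ge0//.
  have [->|fx0] := eqVneq (f x) 0; first by rewrite invr0 mul0r.
  by rewrite expr2 invfM mulrA divff// mul1r.
apply: measurable_funM => //; apply: (measurableT_comp (f := @powR R ^~ (-1))) => //.
exact: measurable_funX.
Qed.

(** Both [B] and [phi] vary, so that the lemma serves for fixed data and also on the product of the
    sample space with the line. *)
Lemma measurable_bf_integrand d (T : measurableType d) n j (B phi : T -> R) :
  measurable_fun setT B -> measurable_fun setT phi ->
  measurable_fun setT (fun x => bf_integrand n j (B x) (phi x)).
Proof.
move=> mB mphi.
have ms : measurable_fun setT (fun x => sin (phi x)).
  apply: measurableT_comp => //; apply: continuous_measurable_fun.
  exact: continuous_sin.
have mP (f : T -> R) (r : R) : measurable_fun setT f ->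
    measurable_fun setT (fun x => (f x + j.+1%:R * sin (phi x) ^+ 2 : R) `^ r).
  move=> mf; apply: (measurableT_comp (f := @powR R ^~ r)) => //.
  apply: measurable_funD => //; apply: measurable_funM => //.
  exact: measurable_funX.
apply: measurable_funM; first apply: measurable_funM.
- exact: measurable_funX.
- exact: mP.
- by apply: measurable_funV => //; apply: mP; exact: measurable_funM.
Qed.

Section integral_bounds.
Variables (n j : nat) (B : R).
Hypotheses (jn : (j < n)%N) (B0 : 0 < B).
Let I : set R := `[0, pi / 2]%classic.

Let sin0 phi : I phi -> 0 <= sin phi.
Proof.
rewrite /I /= in_itv/= => /andP[h0 h1]; apply: sin_ge0_pi.
rewrite h0 (le_trans h1)// ler_pdivrMr// ler_peMr ?ler1n//.
exact: pi_ge0.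
Qed.

Let mI : measurable I. Proof. exact: measurable_itv. Qed.

Let muI : lebesgue_measure I = (pi / 2)%:E.
Proof.
rewrite /I lebesgue_measure_itv /= lte_fin divr_gt0 ?pi_gt0//=.
by rewrite oppr0 adde0.
Qed.

Let integrable_cst (k : R) : lebesgue_measure.-integrable I (EFin \o cst k).
Proof.
apply: measurable_bounded_integrable => //; first by rewrite /= muI ltry.
exists `|k|; split; first by rewrite num_real.
by move=> x xk phi _; rewrite /= ltW.
Qed.

Lemma integrable_bf_integrand :
  lebesgue_measure.-integrable I (EFin \o bf_integrand n j B).
Proof.
have := integrable_cst (expR (j.+1%:R / 2) * bf_rate n j B).
apply: le_integrable => //.
- apply/measurable_EFinP; apply: measurable_funTS.
  exact: measurable_bf_integrand.
- move=> phi Iphi; rewrite /= lee_fin !ger0_norm ?bf_integrand_ge0 ?sin0//.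
    by rewrite bf_integrand_ub// sin0.
  by rewrite mulr_ge0 ?expR_ge0// mulr_ge0 ?powR_ge0.
Qed.

Lemma bf_integral_ub : \int[lebesgue_measure]_(phi in I) bf_integrand n j B phi
  <= pi / 2 * (expR (j.+1%:R / 2) * bf_rate n j B).
Proof.
rewrite mulrC; have -> : pi / 2 = fine (lebesgue_measure I) by rewrite muI.
rewrite -Rintegral_cst//; apply: le_Rintegral => //.
- exact: integrable_bf_integrand.
- exact: integrable_cst.
- by move=> phi Iphi; rewrite bf_integrand_ub// sin0.
Qed.

(** For [j > 1] the integrand vanishes at 0, so the integral is restricted to [[pi/4, pi/2]], where
    the sine is at least [sin (pi / 4)]. *)
Lemma bf_integral_lb (delta : R) : 0 < delta <= B ->
  pi / 4 * (sin (pi / 4) ^+ (j - 1) * expR (- (j.+1%:R / (delta *+ 2)))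
            * bf_rate n j B)
  <= \int[lebesgue_measure]_(phi in I) bf_integrand n j B phi.
Proof.
move=> dB; pose J : set R := `[pi / 4, pi / 2]%classic.
have pi4 : 0 < pi / 4 :> R by rewrite divr_gt0 ?pi_gt0.
have JI : (J `<=` I)%classic.
  move=> x; rewrite /J /I /= !in_itv/= => /andP[x0 ->]; rewrite andbT.
  exact: le_trans (ltW pi4) x0.
have mJ : measurable J by exact: measurable_itv.
have muJ : lebesgue_measure J = (pi / 4)%:E.
  rewrite /J lebesgue_measure_itv /= lte_fin.
  have -> : pi / 2 = pi / 4 + pi / 4 :> R by field.
  by rewrite ltrDl pi4 -EFinB addrK.
set c := _ * bf_rate n j B.
have cf phi : J phi -> c <= bf_integrand n j B phi.
  move=> Jphi; apply: bf_integrand_lb => //; first exact/sin0/JI.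
  have pi2 : 0 < pi :> R := pi_gt0 R.
  rewrite (ltW (sin_gt0_pihalf _)) ?pi4/=; last by lra.
  move: Jphi; rewrite /J /= in_itv/= => /andP[p1 p2].
  by rewrite leNgt ltr_sin ?in_itv/= -?leNgt//; apply/andP; split; lra.
rewrite mulrC; have -> : pi / 4 = fine (lebesgue_measure J) by rewrite muJ.
have If := integrable_bf_integrand.
rewrite -Rintegral_cst//.
apply: (@le_trans _ _ (\int[lebesgue_measure]_(phi in J) bf_integrand n j B phi)).
  apply: le_Rintegral => //; last exact: integrableS If.
  apply: measurable_bounded_integrable => //; first by rewrite /= muJ ltry.
  exists `|c|; split; first by rewrite num_real.
  by move=> x xk phi _; rewrite /= ltW.
rewrite /Rintegral fine_le ?integrable_fin_num//.
  exact: integrableS If.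
apply: ge0_subset_integral => //; first by case/integrableP: If.
by move=> phi Iphi; rewrite lee_fin bf_integrand_ge0// sin0.
Qed.

End integral_bounds.

(** The prefactor [2 / pi] cancels the length [pi / 2] of the interval here; against the length
    [pi / 4] used for the lower bound it leaves the 1/2 of [bf_lb_const]. *)
Definition bf_ub_const (j : nat) : R :=
  j.+1%:R `^ ((j%:R - 1) / 2) * expR (j.+1%:R / 2).

Definition bf_lb_const (j : nat) (delta : R) : R :=
  j.+1%:R `^ ((j%:R - 1) / 2) / 2
  * (sin (pi / 4) ^+ (j - 1) * expR (- (j.+1%:R / (delta *+ 2)))).

Lemma bf_lb_const_gt0 j delta : 0 < bf_lb_const j delta.
Proof.
have pi2 : 0 < pi :> R := pi_gt0 R.
rewrite mulr_gt0 ?divr_gt0 ?powR_gt0// mulr_gt0 ?expR_gt0// exprn_gt0//.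
by apply: sin_gt0_pihalf; apply/andP; split; lra.
Qed.

Section bf_vs_null.
Context {p n : nat} (X : 'M[R]_(n, p.+1)) (y : 'cV[R]_n).
Implicit Types M : {set 'I_p.+1}.

Lemma bf_vs_nullE M : M != null_model p ->
  bf_vs_null X y M = 2 / pi * #|M|.+1%:R `^ ((#|M|%:R - 1) / 2) *
    \int[lebesgue_measure]_(phi in `[0%R, (pi / 2)%R]%classic)
      bf_integrand n #|M| (rss_ratio X y (null_model p) M) phi.
Proof.
move=> M1; rewrite /bf_vs_null (negbTE M1) /bayes_factor invrK.
by rewrite {1 2 3}/null_model cards1.
Qed.

Lemma bf_vs_null_ge0 M : 0 <= bf_vs_null X y M.
Proof.
have [->|M1] := eqVneq M (null_model p); first by rewrite /bf_vs_null eqxx.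
rewrite bf_vs_nullE// !mulr_ge0 ?invr_ge0 ?pi_ge0 ?powR_ge0//.
apply: Rintegral_ge0 => phi; rewrite /= in_itv/= => /andP[h0 h1].
have pi0 : 0 <= pi :> R := pi_ge0 R.
by apply: bf_integrand_ge0; apply: sin_ge0_pi; apply/andP; split; lra.
Qed.

Hypothesis pn : (p.+1 < n)%N.

Let card_lt M : (#|M| < n)%N.
Proof. by rewrite (leq_ltn_trans (max_card _))// card_ord. Qed.

Lemma card_null_model : #|null_model p| = 1%N.
Proof. exact: cards1. Qed.

Lemma rss_ratio_null : 0 < qform (1%:M - hat X (null_model p)) y ->
  rss_ratio X y (null_model p) (null_model p) = 1.
Proof. by move=> r1; rewrite /rss_ratio divff ?gt_eqF. Qed.

Lemma bf_vs_null_ub M :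
  0 < qform (1%:M - hat X (null_model p)) y ->
  0 < qform (1%:M - hat X M) y ->
  bf_vs_null X y M
  <= bf_ub_const #|M| * bf_rate n #|M| (rss_ratio X y (null_model p) M).
Proof.
(* The null model has Bayes factor 1 by convention. Its rate is 1 and its constant at least 1, so it
   obeys the same bound as the others. *)
move=> r1 rM; have [->|M1] := eqVneq M (null_model p).
  rewrite /bf_vs_null eqxx /bf_ub_const /bf_rate rss_ratio_null// card_null_model.
  rewrite subrr mul0r !powRr0 powR1 !mul1r mulr1.
  by rewrite -expR0 ler_expR divr_ge0.
have B0 : 0 < rss_ratio X y (null_model p) M by rewrite divr_gt0.
rewrite bf_vs_nullE// /bf_ub_const (mulrC (2 / pi)) -!mulrA ler_pM2l ?powR_gt0//.
rewrite mulrA -ler_pdivlMl ?divr_gt0 ?pi_gt0//.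
by rewrite invf_div bf_integral_ub.
Qed.

Lemma bf_vs_null_lb M (delta : R) :
  0 < qform (1%:M - hat X (null_model p)) y ->
  0 < delta <= rss_ratio X y (null_model p) M ->
  bf_lb_const #|M| delta * bf_rate n #|M| (rss_ratio X y (null_model p) M)
  <= bf_vs_null X y M.
Proof.
move=> r1 dB; have /andP[d0 d_B] := dB.
have B0 := lt_le_trans d0 d_B.
(* For the null model the rate is again 1, and the constant is at most 1/2. *)
have [->|M1] := eqVneq M (null_model p).
  rewrite /bf_vs_null eqxx /bf_lb_const /bf_rate rss_ratio_null// card_null_model.
  rewrite subrr mul0r !powRr0 powR1 !mul1r !mulr1.
  have : expR (- (2 / (delta *+ 2))) <= 1 :> R.
    by rewrite -[leRHS]expR0 ler_expR oppr_le0 divr_ge0// mulrn_wge0// ltW.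
  lra.
rewrite bf_vs_nullE// /bf_lb_const (mulrC (2 / pi)) -!mulrA ler_pM2l ?powR_gt0//.
rewrite [leRHS]mulrA -ler_pdivrMl ?divr_gt0 ?pi_gt0//.
have := bf_integral_lb (card_lt M) B0 dB.
apply: le_trans.
rewrite -!mulrA invf_div.
set a := sin _ ^+ _; set b := expR _; set c := bf_rate _ _ _.
by rewrite le_eqVlt; apply/orP; left; apply/eqP; field.
Qed.

End bf_vs_null.

End bayes_factor_bounds.

(** * Measurability of the posterior probabilities *)

Section posterior_measurable.
Context {R : realType} {d : measure_display} {Omega : measurableType d}.

(** By Tonelli's theorem on the product of the sample space with the line. The indicator of the
    interval makes the integrand nonnegative everywhere, since the sine may be negative outside. *)
Lemma measurable_bf_integral n j (B : Omega -> R) : measurable_fun setT B ->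
  measurable_fun setT (fun w => \int[lebesgue_measure]_(phi in
    `[0%R, (pi / 2)%R]%classic) bf_integrand n j (B w) phi).
Proof.
move=> mB; set I : set R := `[0, pi / 2]%classic.
pose f (z : Omega * R) : R := bf_integrand n j (B z.1) z.2 * \1_I z.2.
have fI w phi : f (w, phi) = ((bf_integrand n j (B w)) \_ I) phi.
  by rewrite /f /= patchE indicE; case: ifP; rewrite ?mulr1 ?mulr0.
have f0 z : 0 <= f z.
  rewrite /f indicE; case: (boolP (z.2 \in I)) => zI; last by rewrite mulr0.
  rewrite mulr1; apply: bf_integrand_ge0; move: zI.
  rewrite inE /I/= in_itv/= => /andP[h0 h1].
  have pi0 : 0 <= pi :> R := pi_ge0 R.
  by apply: sin_ge0_pi; apply/andP; split; lra.
have mf : measurable_fun setT f.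
  apply: measurable_funM.
    apply: measurable_bf_integrand; first exact: measurableT_comp.
    exact: measurable_snd.
  apply: measurableT_comp; last exact: measurable_snd.
  by apply: measurable_indic; exact: measurable_itv.
have := @measurable_fun_fubini_tonelli_F _ _ Omega _ R
  (@lebesgue_measure R) (EFin \o f) _ _.
have -> : fubini_F (@lebesgue_measure R) (EFin \o f) =
    fun w => (\int[lebesgue_measure]_(phi in I) (bf_integrand n j (B w) phi)%:E)%E.
  apply/funext => w; rewrite /fubini_F [RHS]integral_mkcond.
  by apply: eq_integral => phi _; rewrite /= fI /patch; case: ifP.
move=> H; rewrite /Rintegral; apply: measurableT_comp => //; apply: H.
  exact/measurable_EFinP.
by move=> z; rewrite lee_fin.
Qed.

Context {P : probability Omega R} {p n : nat} (X : 'M[R]_(n, p.+1))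
  (y : 'I_n -> {RV P >-> R}).

Lemma measurable_qform (A : 'M[R]_n) :
  measurable_fun setT (fun w => qform A (sample y w)).
Proof.
have -> : (fun w => qform A (sample y w))
    = (fun w => \sum_i (\sum_j y j w * A j i) * y i w).
  apply/funext => w; rewrite /qform mxE; apply: eq_bigr => i _.
  by rewrite !mxE; congr (_ * _); apply: eq_bigr => j _; rewrite !mxE.
apply: measurable_sum => i; apply: measurable_funM => //.
by apply: measurable_sum => j; apply: measurable_funM.
Qed.

Lemma measurable_bf_vs_null M :
  measurable_fun setT (fun w => bf_vs_null X (sample y w) M).
Proof.
have [->|M1] := eqVneq M (null_model p).
  by rewrite /bf_vs_null eqxx.
under eq_fun do rewrite bf_vs_nullE//.
apply: measurable_funM => //; apply: measurable_bf_integral.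
apply: measurable_funM; first exact: measurable_qform.
by apply: measurable_funV => //; exact: measurable_qform.
Qed.

(* A measure takes junk values on non-measurable sets, so convergence in
   probability is only meaningful for measurable functions. *)
Lemma measurable_posterior M :
  measurable_fun setT (fun w => posterior X (sample y w) M).
Proof.
apply: measurable_funM; first exact: measurable_bf_vs_null.
apply: measurable_funV => //; apply: measurable_funD => //.
rewrite [X in measurable_fun _ X](_ : _ = fun w => \sum_(N : {set 'I_p.+1})
  if (N \in models p) && (N != null_model p)
  then bf_vs_null X (sample y w) N else 0); last first.
  by apply/funext => w; rewrite big_mkcond.
apply: measurable_sum => N /=; case: (_ && _) => //.
exact: measurable_bf_vs_null.
Qed.

End posterior_measurable.

(** * Moments of independent normal errors *)

Section lebesgue_invariance.
Context {R : realType}.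
Local Notation mu := (@lebesgue_measure R).

(** Lebesgue measure is determined by its values on half-open intervals. *)
Lemma pushforward_lebesgue (f : R -> R) : measurable_fun setT f ->
  (forall a b : R, a < b -> mu (f @^-1` `]a, b]%classic) = (b - a)%:E) ->
  forall A : set R, measurable A -> pushforward mu f A = mu A.
Proof.
move=> mf fab A mA; apply/esym.
apply: (@lebesgue_measure_unique R
  (@measure_function_pushforward__canonical__measure_function_Measure
     _ _ (measurableTypeR R) (measurableTypeR R) R mu f mf)) => //.
move=> _ /ocitvP[->|[[a b]/= ab ->]]; first by rewrite !measure0.
by rewrite /= /pushforward fab// lebesgue_measure_itv/= lte_fin ab.
Qed.

Lemma lebesgue_measure_shift (m : R) (A : set R) : measurable A ->
  pushforward mu (fun x : R => x - m) A = mu A.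
Proof.
apply: pushforward_lebesgue; first exact: measurable_funB.
move=> a b ab; rewrite [X in mu X](_ : _ = `]a + m, b + m]%classic).
  rewrite lebesgue_measure_itv/= lte_fin ltrD2r ab -EFinB; congr _%:E; ring.
by apply/seteqP; split=> x /=; rewrite !in_itv/= ltrBrDr lerBlDr.
Qed.

Lemma lebesgue_measure_opp (A : set R) : measurable A ->
  pushforward mu (fun x : R => - x) A = mu A.
Proof.
apply: pushforward_lebesgue; first exact: oppr_measurable.
move=> a b ab; rewrite [X in mu X](_ : _ = `[- b, - a[%classic).
  by rewrite lebesgue_measure_itv/= lte_fin ltrN2 ab -EFinB opprK addrC.
by apply/seteqP; split=> x /=; rewrite !in_itv/= ltrNr lerNl andbC.
Qed.

Lemma ge0_integral_lebesgue_invariant (f : R -> R) (h : R -> \bar R) :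
  measurable_fun setT f ->
  (forall A : set R, measurable A -> pushforward mu f A = mu A) ->
  measurable_fun setT h -> (forall x, 0 <= h x)%E ->
  (\int[mu]_x h (f x) = \int[mu]_x h x)%E.
Proof.
move=> mf fmu mh h0.
have mf' : @measurable_fun _ _ (measurableTypeR R) (measurableTypeR R) setT f.
  exact: mf.
transitivity (\int[@pushforward _ _ (measurableTypeR R) (measurableTypeR R) R
  mu f]_x h x)%E.
  by rewrite ge0_integral_pushforward// preimage_setT.
apply: (@eq_measure_integral _ _ _ _ mu
  (measure_function_pushforward__canonical__measure_function_Measure mu mf')).
by move=> A mA _; exact: fmu.
Qed.

End lebesgue_invariance.

Section normal_invariance.
Context {R : realType} (sigma : R).
Local Notation mu := (@lebesgue_measure R).
Local Notation nu := (@normal_prob R 0 sigma).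
Hypothesis sigma0 : 0 < sigma.

(** A map that preserves Lebesgue measure and carries one density to the other carries the laws
    along. Centring and reflection are the two instances. *)
Lemma normal_prob_invariant (f : R -> R) (m m' : R) :
  measurable_fun setT f ->
  (forall A : set R, measurable A -> pushforward mu f A = mu A) ->
  (forall x, normal_pdf m' sigma (f x) = normal_pdf m sigma x) ->
  forall A : set R, measurable A ->
  normal_prob m sigma (f @^-1` A) = normal_prob m' sigma A.
Proof.
move=> mf fmu fpdf A mA; rewrite /normal_prob.
rewrite integral_mkcond [RHS]integral_mkcond.
rewrite -[RHS](ge0_integral_lebesgue_invariant mf fmu).
- apply: eq_integral => x _; rewrite !patchE fpdf.
  by congr (if _ then _ else _); apply/idP/idP; rewrite !inE.
- apply/(measurable_restrictT _ mA)/measurable_funTS/measurable_EFinP.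
  exact: measurable_normal_pdf.
- by move=> x; rewrite patchE; case: ifP => // _; rewrite lee_fin normal_pdf_ge0.
Qed.

Lemma normal_prob_center (m : R) (A : set R) : measurable A ->
  normal_prob m sigma ((fun x => x - m) @^-1` A) = nu A.
Proof.
apply: normal_prob_invariant; first exact: measurable_funB.
  exact: lebesgue_measure_shift.
by move=> x; rewrite /normal_pdf gt_eqF//= /normal_fun subr0.
Qed.

Lemma normal_prob_opp (A : set R) : measurable A ->
  nu ((fun x => - x) @^-1` A) = nu A.
Proof.
apply: normal_prob_invariant; first exact: oppr_measurable.
  exact: lebesgue_measure_opp.
by move=> x; rewrite /normal_pdf gt_eqF//= /normal_fun !subr0 sqrrN.
Qed.

End normal_invariance.

Section normal_moments.
Context {R : realType}.
Local Notation mu := (@lebesgue_measure R).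

(** The explicit density agrees almost everywhere with the Radon-Nikodym derivative, having the same
    integral over each measurable set. *)
Lemma ge0_integral_normal_prob (m sigma : R) (f : R -> \bar R) :
  measurable_fun setT f -> (forall x, 0 <= f x)%E ->
  (\int[normal_prob m sigma]_x f x =
   \int[mu]_x (f x * (normal_pdf m sigma x)%:E))%E.
Proof.
move=> mf f0; have dom := normal_prob_dominates m sigma.
rewrite -(Radon_Nikodym_SigmaFinite.change_of_variables dom)//.
have mpdf : measurable_fun [set: R] (fun x => (normal_pdf m sigma x)%:E).
  by apply/measurable_EFinP; exact: measurable_normal_pdf.
have ig := Radon_Nikodym_SigmaFinite.f_integrable dom.
apply: ae_eq_integral => //.
- by apply: emeasurable_funM => //; exact: measurable_int ig.
- exact: emeasurable_funM.
- apply: ae_eqe_mul2l; apply: integral_ae_eq => // E _ mE.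
  by rewrite -Radon_Nikodym_SigmaFinite.f_integral.
Qed.

(** Doubling the variance halves the exponent of the density, and the other half absorbs [x ^+ 4].
    So the integrand is dominated by a multiple of the density of standard deviation [tau], whose
    integral is 1. *)
Lemma normal_fourth_moment (sigma : R) : 0 < sigma ->
  (normal_prob 0 sigma).-integrable setT (fun x : R => (x ^+ 4)%:E).
Proof.
move=> s0; pose tau := Num.sqrt 2 * sigma.
have tau0 : 0 < tau by rewrite mulr_gt0// sqrtr_gt0.
(* 32 is 16 times 2: with [u = x^2 / (4 sigma^2)], [x^4] is [16 sigma^4 u^2], and
   [u^2 expR (- u) <= 2]. *)
pose C := 32 * sigma ^+ 4 * normal_peak sigma / normal_peak tau.
have tau2 : tau ^+ 2 = 2 * sigma ^+ 2 by rewrite exprMn sqr_sqrtr.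
have pt0 : 0 < normal_peak tau by rewrite normal_peak_gt0// gt_eqF.
have s4 : 0 <= sigma ^+ 4 by rewrite exprn_ge0 ?(ltW s0).
have C0 : 0 <= C.
  rewrite /C divr_ge0 ?normal_peak_ge0// mulr_ge0 ?normal_peak_ge0//.
  by rewrite mulr_ge0.
(* u^2 <= 2 exp u for u = x^2 / (4 sigma^2), and the density of N(0, sigma^2)
   is a constant times exp (- 2 u). *)
have bound x : x ^+ 4 * normal_pdf 0 sigma x <= C * normal_pdf 0 tau x.
  rewrite /normal_pdf !gt_eqF//= /normal_fun subr0 tau2.
  set u := x ^+ 2 / (4 * sigma ^+ 2).
  have s20 : 0 < sigma ^+ 2 by rewrite exprn_gt0.
  have u0 : 0 <= u by rewrite divr_ge0 ?sqr_ge0// mulr_ge0// (ltW s20).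
  have -> : - x ^+ 2 / (sigma ^+ 2 *+ 2) = - u - u.
    by rewrite /u; field; rewrite gt_eqF.
  have -> : - x ^+ 2 / (2 * sigma ^+ 2 *+ 2) = - u.
    by rewrite /u; field; rewrite gt_eqF.
  have -> : x ^+ 4 = 16 * sigma ^+ 4 * u ^+ 2.
    by rewrite /u; field; rewrite gt_eqF.
  rewrite expRD; have u2 : u ^+ 2 * expR (- u) <= 2.
    rewrite expRN ler_pdivrMr ?expR_gt0//.
    have := expR_ge1Dxn 1 u0; rewrite (_ : 2`!%:R = 2)// => h.
    have := expR_gt0 u; lra.
  rewrite /C.
  have -> : 32 * sigma ^+ 4 * normal_peak sigma / normal_peak tau *
    (normal_peak tau * expR (- u))
    = (16 * sigma ^+ 4 * normal_peak sigma * expR (- u)) * 2.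
    by field; rewrite gt_eqF.
  have -> : 16 * sigma ^+ 4 * u ^+ 2 *
    (normal_peak sigma * (expR (- u) * expR (- u)))
    = (16 * sigma ^+ 4 * normal_peak sigma * expR (- u)) * (u ^+ 2 * expR (- u)).
    by ring.
  apply: ler_wpM2l => //.
  rewrite mulr_ge0 ?expR_ge0// mulr_ge0 ?normal_peak_ge0//.
  by rewrite mulr_ge0.
have m4 : measurable_fun [set: R] (fun x : R => (x ^+ 4)%:E).
  by apply/measurable_EFinP; exact: exprn_measurable.
apply/integrableP; split => //.
have -> : (\int[normal_prob 0 sigma]_x `|(x ^+ 4)%:E|
    = \int[normal_prob 0 sigma]_x (x ^+ 4)%:E)%E.
  apply: eq_integral => x _; rewrite gee0_abs// lee_fin.
  by rewrite exprn_even_ge0.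
have p4 (x : R) : 0 <= x ^+ 4 by exact: exprn_even_ge0.
rewrite ge0_integral_normal_prob//.
apply: (@le_lt_trans _ _ (\int[mu]_x (C%:E * (normal_pdf 0 tau x)%:E))%E).
  apply: ge0_le_integral => //.
  - by move=> x _; rewrite mule_ge0 ?lee_fin ?normal_pdf_ge0.
  - apply: emeasurable_funM => //; apply/measurable_EFinP.
    exact: measurable_normal_pdf.
  - apply: emeasurable_funM => //; apply/measurable_EFinP.
    exact: measurable_normal_pdf.
  - by move=> x _; rewrite -!EFinM lee_fin.
rewrite ge0_integralZl//.
- by rewrite integral_normal_pdf mule1 ltry.
- by apply/measurable_EFinP; exact: measurable_normal_pdf.
- by move=> x _; rewrite lee_fin normal_pdf_ge0.
Qed.

(** By symmetry the mean equals its opposite; integrability makes it finite, hence 0. *)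
Lemma normal_mean0 (sigma : R) : 0 < sigma ->
  (normal_prob 0 sigma).-integrable setT (fun x : R => x%:E) ->
  (\int[normal_prob 0 sigma]_x x%:E = 0)%E.
Proof.
move=> s0 ix; set nu := normal_prob 0 sigma.
have mopp : @measurable_fun _ _ (measurableTypeR R) (measurableTypeR R) setT
    (fun x : R => - x).
  exact: (@oppr_measurable R setT).
have : (\int[nu]_x x%:E = \int[nu]_x (- x)%:E)%E.
  transitivity (\int[@pushforward _ _ (measurableTypeR R) (measurableTypeR R) R
      nu (fun x : R => (- x)%R)]_x x%:E)%E.
    symmetry; apply: (@eq_measure_integral _ _ _ _ nu
      (measure_function_pushforward__canonical__measure_function_Measure nu mopp)).
    by move=> A mA _; exact: normal_prob_opp.
  rewrite integral_pushforward//.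
  have := integrableN ix; apply: eq_integrable => // x _.
have -> : (\int[nu]_x (- x)%:E = - \int[nu]_x x%:E)%E.
  under eq_integral do rewrite -mulN1r EFinM.
  by rewrite integralZl// mulN1e.
have := integrable_fin_num measurableT ix.
rewrite -/nu; case: (\int[nu]_x x%:E)%E => // r _ [] rr.
by congr _%:E; lra.
Qed.

End normal_moments.

Lemma markov_ge0 d (T : measurableType d) (R : realType)
    (P : probability T R) (f : T -> R) (c e : R) : measurable_fun setT f ->
  (forall w, 0 <= f w) -> 0 < c -> (\int[P]_w (f w)%:E = e%:E)%E ->
  (P [set w | (c <= f w)%R] <= (c^-1 * e)%:E)%E.
Proof.
move=> mf f0 c0 Ef.
have := @le_integral_comp_abse _ T R P setT measurableT (EFin \o f) c id _ _ _ _ c0.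
rewrite setTI => H; rewrite EFinM lee_pdivlMl// -Ef.
have -> : [set w | (c <= f w)%R] = [set w | (c%:E <= `|(EFin \o f) w|)%E].
  by apply/seteqP; split => w /=; rewrite lee_fin ger0_norm.
rewrite [leRHS](_ : _ = \int[P]_w id `|(EFin \o f) w|%E)%E; last first.
  by apply: eq_integral => w _ /=; rewrite ger0_norm.
apply: H => //; exact/measurable_EFinP.
Qed.

(** * Second moments of linear forms in independent variables *)

Section iid_second_moment.
Context {R : realType} {d : measure_display} {Omega : measurableType d}.
Variables (P : probability Omega R) (nu : probability (measurableTypeR R) R).
Variables (n : nat) (Z : 'I_n -> Omega -> measurableTypeR R).
Hypothesis mZ : forall i, measurable_fun setT (Z i).
Hypothesis iid : forall B : 'I_n -> set R, (forall i, measurable (B i)) ->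
  P [set w | forall i, B i (Z i w)] = (\prod_(i < n) nu (B i))%E.

(** A marginal law comes from the box formula by taking the whole line in every other coordinate;
    the next lemma does this for pairs. *)
Lemma iid_law1 i (A : set R) : measurable A -> P (Z i @^-1` A) = nu A.
Proof.
move=> mA; pose B k : set R := if k == i then A else setT.
have mB k : measurable (B k) by rewrite /B; case: ifP.
have := iid mB; rewrite (bigD1 i)//= {2}/B eqxx big1 ?mule1.
  move=> <-; congr (P _); apply/seteqP; split => w /=.
    by move=> Aw k; rewrite /B; case: eqP => // ->.
  by move=> /(_ i); rewrite /B eqxx.
by move=> k ki; rewrite /B (negbTE ki) probability_setT.
Qed.

Lemma iid_law2 i j (A A' : set R) : i != j -> measurable A -> measurable A' ->
  P ((fun w => (Z i w, Z j w)) @^-1` (A `*` A')) = (nu A * nu A')%E.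
Proof.
move=> ij mA mA'.
pose B k : set R := if k == i then A else if k == j then A' else setT.
have mB k : measurable (B k) by rewrite /B; case: ifP => //; case: ifP.
have := iid mB; rewrite (bigD1 i)//= (bigD1 j) 1?eq_sym//= big1 ?mule1.
  rewrite {2 3}/B eqxx [j == i]eq_sym (negbTE ij) eqxx => <-; congr (P _).
  apply/seteqP; split => w /=.
    by move=> [Aw A'w] k; rewrite /B; case: eqP => [->//|_]; case: eqP => // ->.
  move=> h; split; first by have := h i; rewrite /B eqxx.
  by have := h j; rewrite /B eq_sym (negbTE ij) eqxx.
by move=> k /andP[ki kj]; rewrite /B (negbTE ki) (negbTE kj) probability_setT.
Qed.

Lemma iid_integral1 i (f : measurableTypeR R -> \bar R) :
  measurable_fun setT f -> (forall x, 0 <= f x)%E ->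
  (\int[P]_w f (Z i w) = \int[nu]_x f x)%E.
Proof.
move=> mf f0.
transitivity (\int[pushforward P (Z i)]_x f x)%E.
  by rewrite ge0_integral_pushforward// preimage_setT.
apply: (@eq_measure_integral _ _ _ _ nu
  (measure_function_pushforward__canonical__measure_function_Measure P (mZ i))).
by move=> A mA _; exact: iid_law1.
Qed.

(** The law of the pair agrees with [nu \x nu] on rectangles, hence everywhere by uniqueness of
    product measures, and Fubini's theorem splits the integral. *)
Lemma iid_integral2 i j (f : measurableTypeR R -> R) : i != j ->
  nu.-integrable setT (EFin \o f) ->
  P.-integrable setT (fun w => (f (Z i w) * f (Z j w))%:E) /\
  (\int[P]_w (f (Z i w) * f (Z j w))%:E
   = (\int[nu]_x (f x)%:E) * (\int[nu]_x (f x)%:E))%E.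
Proof.
move=> ij intf; have mfE := measurable_int _ intf.
have mf : measurable_fun [set: measurableTypeR R] f by exact/measurable_EFinP.
pose g (z : measurableTypeR R * measurableTypeR R) := (f z.1 * f z.2)%:E.
have mg : measurable_fun setT g.
  by apply/measurable_EFinP; apply: measurable_funM; apply: measurableT_comp.
pose ZZ w : measurableTypeR R * measurableTypeR R := (Z i w, Z j w).
have mZZ : measurable_fun setT ZZ by exact: measurable_fun_pair.
pose PZ := measure_function_pushforward__canonical__measure_function_Measure
  P mZZ.
have PZE A : measurable A -> PZ A = (nu \x nu)%E A.
  move=> mA; symmetry; apply: product_measure_unique => // B C mB mC.
  exact: iid_law2.
have absg x y : (`|g (x, y)| = `|f x|%:E * `|f y|%:E)%E.
  by rewrite /g /= normrM EFinM.
have fin : (\int[nu]_x `|(f x)%:E| < +oo)%E by case/integrableP: intf.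
have mabs : measurable_fun setT (fun x => `|(f x)%:E|%E).
  exact: measurableT_comp.
have gprod : (nu \x nu)%E.-integrable setT g.
  apply/(integrable12ltyP _ _ mg).
  under eq_integral.
    move=> x _; under eq_integral do rewrite absg.
    rewrite ge0_integralZl//; over.
  rewrite ge0_integralZr// ?lte_mul_pinfty ?integral_ge0//.
  by rewrite ge0_fin_numE ?integral_ge0.
have EPZ h : (\int[PZ]_z h z = \int[(nu \x nu)%E]_z h z)%E.
  apply: (@eq_measure_integral _ _ _ _ (nu \x nu)%E PZ) => A mA _.
  exact: PZE.
have Pint : P.-integrable setT (g \o ZZ).
  apply/integrableP; split; first exact: measurableT_comp.
  have := @ge0_integral_pushforward _ _ _ _ _ _ mZZ P setT (abse \o g).
  rewrite preimage_setT => <- //; last by move=> z _; exact: abse_ge0.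
    by rewrite EPZ; case/integrableP: gprod.
  exact: measurableT_comp.
split; first exact: Pint.
transitivity (\int[PZ]_z g z)%E.
  by rewrite [RHS]integral_pushforward.
rewrite EPZ -integral12_prod_meas1// /fubini_F.
under eq_integral.
  move=> x _; under eq_integral do rewrite /g/= EFinM.
  rewrite integralZl//; over.
rewrite -(fineK (integrable_fin_num measurableT intf)) integralZr// fineK//.
exact: integrable_fin_num.
Qed.

(** Expand the square: the off-diagonal terms have mean 0. It is applied below to the identity and
    to [x ^+ 2 - s]. *)
Lemma iid_second_moment (f : measurableTypeR R -> R) (v : R) (a : 'I_n -> R) :
  measurable_fun setT f ->
  (\int[nu]_x (f x)%:E = 0)%E -> (\int[nu]_x (f x ^+ 2)%:E = v%:E)%E ->
  (\int[P]_w ((\sum_i a i * f (Z i w)) ^+ 2)%:E = (v * \sum_i a i ^+ 2)%:E)%E.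
Proof.
move=> mf f0 f2.
have intf2 : nu.-integrable setT (fun x => (f x ^+ 2)%:E).
  apply/integrableP; split; first by apply/measurable_EFinP/measurable_funX.
  under eq_integral do rewrite gee0_abs ?lee_fin ?sqr_ge0//.
  by rewrite f2 ltry.
(* By domination, from [|f| <= 1 + f ^+ 2]. *)
have intf : nu.-integrable setT (EFin \o f).
  have int1 : nu.-integrable setT (cst 1%E).
    exact: (finite_measure_integrable_cst nu 1 measurableT).
  apply: le_integrable (integrableD measurableT int1 intf2) => //.
    exact/measurable_EFinP.
  move=> x _ /=; rewrite lee_fin [leRHS]ger0_norm ?addr_ge0 ?sqr_ge0//.
  rewrite -(real_normK (num_real (f x))).
  have := sqr_ge0 (`|f x| - 1); have := normr_ge0 (f x); nra.
have intZ i j : P.-integrable setT (fun w => (f (Z i w) * f (Z j w))%:E) /\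
  (\int[P]_w (f (Z i w) * f (Z j w))%:E = (if i == j then v else 0)%:E)%E.
  have [->|ij] := eqVneq i j; last first.
    by have [? ->] := iid_integral2 ij intf; rewrite f0 mule0.
  have H := @iid_integral1 j (fun x => (f x ^+ 2)%:E); rewrite f2 in H.
  have {}H : (\int[P]_w (f (Z j w) * f (Z j w))%:E = v%:E)%E.
    rewrite -H//; first by apply/measurable_EFinP/measurable_funX.
    by move=> x; rewrite lee_fin sqr_ge0.
  split => //; apply/integrableP; split.
    apply/measurable_EFinP; apply: measurable_funM; exact: measurableT_comp.
  under eq_integral do rewrite gee0_abs ?lee_fin -?expr2 ?sqr_ge0// expr2.
  by rewrite H ltry.
have expand w : (((\sum_i a i * f (Z i w)) ^+ 2)%:E =
    \sum_i \sum_j (a i * a j)%:E * (f (Z i w) * f (Z j w))%:E)%E.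
  rewrite expr2 mulr_suml -sumEFin; apply: eq_bigr => i _.
  rewrite mulr_sumr -sumEFin; apply: eq_bigr => j _.
  by rewrite -EFinM mulrACA.
under eq_integral do rewrite expand.
rewrite integral_sum//; last first.
  move=> i; apply: integrable_sum => // j _; apply: integrableZl => //.
  by case: (intZ i j).
rewrite mulr_sumr -sumEFin; apply: eq_bigr => i _.
rewrite integral_sum//; last first.
  by move=> j; apply: integrableZl => //; case: (intZ i j).
rewrite (bigD1 i)//= big1 ?addr0.
  rewrite integralZl//; last by case: (intZ i i).
  by have [_ ->] := intZ i i; rewrite eqxx ?adde0 -EFinM -expr2 mulrC.
move=> j ji; rewrite integralZl//; last by case: (intZ i j).
by have [_ ->] := intZ i j; rewrite eq_sym (negbTE ji) mule0.
Qed.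

End iid_second_moment.

(** * Decay of the posterior ratio *)

Lemma div_div_cancel (F : fieldType) (a b c : F) : c != 0 ->
  (a / c) / (b / c) = a / b.
Proof. by move=> c0; rewrite invf_div mulrA divfK. Qed.

Section posterior_ratio.
Context {R : realType} {p n : nat} (X : 'M[R]_(n, p.+1)) (y : 'cV[R]_n).
Implicit Types M T : {set 'I_p.+1}.
Hypothesis pn : (p.+1 < n)%N.

Lemma bf_rate_ratio i j (B B' : R) : 0 < B -> 0 < B' ->
  bf_rate n j B / bf_rate n i B'
  = n%:R `^ ((i%:R - j%:R) / 2) * (B' / B) `^ ((n%:R - 1) / 2).
Proof.
move=> B0 B'0; have n0 : n%:R != 0 :> R by rewrite pnatr_eq0 -lt0n (leq_ltn_trans _ pn).
rewrite /bf_rate invfM mulrACA; congr (_ * _).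
  by rewrite -powRB ?n0 ?implybT//; congr (_ `^ _); field.
have E q : B' `^ q = (B' / B) `^ q * B `^ q.
  by rewrite -powRM ?divr_ge0 ?(ltW B0) ?(ltW B'0)// divfK ?gt_eqF.
rewrite !powRN invrK E mulrCA mulVf ?mulr1//.
by rewrite gt_eqF// powR_gt0.
Qed.

(** The normalising sums cancel. The upper bound is used for [M] and the lower bound for [T], and
    the residual sum of squares of the null model drops out of the quotient of the two ratios. *)
Lemma posterior_ratio_le M T (delta : R) :
  0 < qform (1%:M - hat X (null_model p)) y ->
  0 < qform (1%:M - hat X M) y -> 0 < qform (1%:M - hat X T) y ->
  0 < delta <= rss_ratio X y (null_model p) T ->
  `|posterior X y M / posterior X y T| <=
  bf_ub_const #|M| / bf_lb_const #|T| delta *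
  (n%:R `^ ((#|T|%:R - #|M|%:R) / 2) *
   (qform (1%:M - hat X T) y / qform (1%:M - hat X M) y) `^ ((n%:R - 1) / 2)).
Proof.
move=> r1 rM rT /[dup] dT /andP[d0 dBT].
have -> : posterior X y M / posterior X y T
    = bf_vs_null X y M / bf_vs_null X y T.
  rewrite /posterior; apply: div_div_cancel; rewrite gt_eqF// ltr_pwDl//.
  by rewrite sumr_ge0// => N _; exact: bf_vs_null_ge0.
have BT0 := lt_le_trans d0 dBT.
have BM0 : 0 < rss_ratio X y (null_model p) M by rewrite divr_gt0.
have n0 : 0 < n%:R :> R by rewrite ltr0n (leq_ltn_trans _ pn).
have rate0 (N : nat) (B : R) : 0 < B -> 0 < bf_rate n N B.
  by move=> B0; apply: mulr_gt0; exact: powR_gt0.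
have ub := bf_vs_null_ub pn r1 rM.
have lb := bf_vs_null_lb pn r1 dT.
have lb0 : 0 < bf_lb_const #|T| delta *
    bf_rate n #|T| (rss_ratio X y (null_model p) T).
  by apply: mulr_gt0; [exact: bf_lb_const_gt0|exact: rate0].
have bT0 : 0 < bf_vs_null X y T.
  exact: lt_le_trans lb0 lb.
rewrite ger0_norm; last first.
  by rewrite divr_ge0 ?bf_vs_null_ge0.
have -> : qform (1%:M - hat X T) y / qform (1%:M - hat X M) y
   = rss_ratio X y (null_model p) T / rss_ratio X y (null_model p) M.
  by apply/esym/div_div_cancel; rewrite gt_eqF.
rewrite -bf_rate_ratio// mulrACA -invfM.
apply: ler_pM; [exact: bf_vs_null_ge0|by rewrite invr_ge0 (ltW bT0)|exact: ub|].
by rewrite lef_pV2 ?posrE; [exact: lb|exact: bT0|exact: lb0].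
Qed.

End posterior_ratio.

Section asymptotics.
Context {R : realType}.

(** With [b = - ln rho / 2] the power of [rho] is [expR b / expR (b n)]. Bounding [expR (b n)] below
    by [(b n)^(k+1) / (k+1)!] leaves [D / n]. *)
Lemma near_exp_decay (rho C eps : R) (k : nat) : 0 < rho < 1 -> 0 < eps ->
  0 <= C -> \forall n \near \oo,
  C * (n%:R ^+ k * rho `^ ((n%:R - 1) / 2)) <= eps.
Proof.
move=> /andP[rho0 rho1] eps0 C0.
pose b := - ln rho / 2; have b0 : 0 < b by rewrite divr_gt0// oppr_gt0 ln_lt0 ?rho0.
pose D := C * expR b * (k.+1)`!%:R / b ^+ k.+1.
near=> n.
have n1 : (0 < n)%N by near: n; exact: nbhs_infty_gt.
have n0 : 0 < n%:R :> R by rewrite ltr0n.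
have Dn : D / eps <= n%:R by near: n; exact: nbhs_infty_ger.
rewrite /powR gt_eqF//.
have -> : (n%:R - 1) / 2 * ln rho = b - b * n%:R by rewrite /b; field.
rewrite expRD expRN.
have bn : 0 < (b * n%:R) ^+ k.+1 / (k.+1)`!%:R.
  by rewrite divr_gt0 ?ltr0n ?fact_gt0// exprn_gt0// mulr_gt0.
have E : (expR (b * n%:R))^-1 <= ((b * n%:R) ^+ k.+1 / (k.+1)`!%:R)^-1.
  rewrite lef_pV2 ?posrE ?expR_gt0//.
  by rewrite (le_trans _ (expR_ge1Dxn k (ltW (mulr_gt0 b0 n0))))// lerDr.
apply: (@le_trans _ _ (C * (n%:R ^+ k * (expR b *
    ((b * n%:R) ^+ k.+1 / (k.+1)`!%:R)^-1)))).
  by rewrite !ler_wpM2l ?expR_ge0 ?exprn_ge0.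
have -> : C * (n%:R ^+ k * (expR b * ((b * n%:R) ^+ k.+1 / (k.+1)`!%:R)^-1))
   = D / n%:R.
  have : (k.+1)`!%:R != 0 :> R by rewrite pnatr_eq0 -lt0n fact_gt0.
  rewrite /D exprMn [n%:R ^+ k.+1]exprS; move: (_`!%:R) => F F0.
  by field; rewrite F0 !gt_eqF ?exprn_gt0.
by rewrite ler_pdivrMr// -ler_pdivrMl// mulrC.
Unshelve. all: by end_near. Qed.

(** The power of [x] is at most [expR (K / 2)], and the exponent of n is at most -1/2 as [t < j] are
    integers. The bound is uniform in [x], which will be a random quotient. *)
Lemma near_poly_decay (C K eps : R) (t j : nat) : (t < j)%N -> 0 < eps ->
  0 <= C -> 0 <= K -> \forall n \near \oo, forall x : R, 0 <= x <= 1 + K / n%:R ->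
  C * (n%:R `^ ((t%:R - j%:R) / 2) * x `^ ((n%:R - 1) / 2)) <= eps.
Proof.
move=> tj eps0 C0 K0; pose D := C * expR (K / 2); near=> n => x /andP[x0 xK].
have n1 : (0 < n)%N by near: n; exact: nbhs_infty_gt.
have n0 : 0 < n%:R :> R by rewrite ltr0n.
have Dn : (D / eps) ^+ 2 <= n%:R by near: n; exact: nbhs_infty_ger.
have D0 : 0 <= D by rewrite mulr_ge0 ?expR_ge0.
have xe : x `^ ((n%:R - 1) / 2) <= expR (K / 2).
  have e0 : 0 <= (n%:R - 1) / 2 :> R by rewrite divr_ge0// subr_ge0 ler1n.
  apply: (@le_trans _ _ ((expR (K / n%:R)) `^ ((n%:R - 1) / 2))).
    by apply: powR_le => //; apply: le_trans xK _; exact: expR_ge1Dx.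
  rewrite -expRM ler_expR.
  have -> : K / n%:R * ((n%:R - 1) / 2) = K / 2 * ((n%:R - 1) / n%:R).
    by field; rewrite gt_eqF.
  by rewrite ler_piMr ?divr_ge0// ler_pdivrMr// mul1r gerBl.
have np : n%:R `^ ((t%:R - j%:R) / 2) <= (Num.sqrt n%:R)^-1 :> R.
  rewrite -powR12_sqrt// -powRN; apply: ler_powR; first by rewrite ler1n.
  have : t%:R + 1 <= j%:R :> R by rewrite natr1 ler_nat.
  lra.
apply: (@le_trans _ _ (C * ((Num.sqrt n%:R)^-1 * expR (K / 2)))).
  by rewrite ler_wpM2l// ler_pM ?powR_ge0.
have -> : C * ((Num.sqrt n%:R)^-1 * expR (K / 2)) = D / Num.sqrt n%:R.
  by rewrite /D; ring.
rewrite ler_pdivrMr ?sqrtr_gt0// -ler_pdivrMl// mulrC.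
by rewrite (le_trans _ (ler_wsqrtr Dn))// sqrtr_sqr ler_norm.
Unshelve. all: by end_near. Qed.

End asymptotics.

Lemma cvg_sumr (R : realType) (I : Type) (r : seq I) (P : pred I)
    (f : I -> nat -> R) (l : I -> R) :
  (forall i, P i -> f i n @[n --> \oo] --> l i) ->
  \sum_(i <- r | P i) f i n @[n --> \oo] --> \sum_(i <- r | P i) l i.
Proof. by move=> fl; apply: cvg_big => //; exact: add_continuous. Qed.

(* nn * q1 + 2 * a1 + ee - b1 is the residual sum of squares of the null model,
   as decomposed by qform_res_decomp, and ee - bT that of the true model. *)
Lemma rss_bounds (R : realType) (nn s eta K q1 Q1 a1 ee b1 bT : R) :
  0 < nn -> 0 < eta -> 16 * eta <= s -> 0 <= Q1 -> `|Q1 - q1| < eta ->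
  K <= nn * eta -> `|ee - nn * s| < nn * eta -> `|a1| < nn * eta ->
  0 <= b1 < K -> 0 <= bT < K ->
  [/\ 0 < nn * q1 + 2 * a1 + ee - b1, nn * (s - 2 * eta) <= ee - bT <= nn * (s + eta)
    & (s - 2 * eta) / (Q1 + s + 4 * eta)
      <= (ee - bT) / (nn * q1 + 2 * a1 + ee - b1)].
Proof.
move=> nn0 eta0 etas Q10; rewrite ltr_norml => /andP[ql qu] Kn.
rewrite !ltr_norml => /andP[el eu] /andP[al au] /andP[b0 bK] /andP[bT0 bTK].
have ne0 : 0 < nn * eta by exact: mulr_gt0.
have ns : 16 * (nn * eta) <= nn * s by rewrite mulrCA ler_wpM2l// ltW.
have nQ : 0 <= nn * Q1 by rewrite mulr_ge0// ltW.
have nl : nn * (Q1 - eta) <= nn * q1 by rewrite ler_wpM2l ?(ltW nn0)//; lra.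
have nu : nn * q1 <= nn * (Q1 + eta) by rewrite ler_wpM2l ?(ltW nn0)//; lra.
rewrite !mulrDr !mulrN in nl nu *.
have rT : nn * s - 2 * (nn * eta) <= ee - bT by lra.
have r1 : 0 < nn * q1 + 2 * a1 + ee - b1 by lra.
split => //; first by apply/andP; split; lra.
have den : 0 < Q1 + s + 4 * eta by lra.
rewrite ler_pdivlMr// mulrAC ler_pdivrMr//.
(* In units of [nn * eta], the null model's sum exceeds [nn * (Q1 + s)] by at most 4: one from the
   drift, two from the cross term, one from the errors. *)
apply: (@le_trans _ _ ((s - 2 * eta) * (nn * (Q1 + s + 4 * eta)))).
  by rewrite ler_wpM2l//; lra.
rewrite mulrA ler_wpM2r ?(ltW den)//; lra.
Qed.

(** The quotient exceeds 1 by [(bM - bT) / (ee - bM)], where the numerator is below [K] and the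
    denominator at least [nn * s / 2]. *)
Lemma rss_ratio_nested (R : realType) (nn s eta K ee bM bT : R) :
  0 < nn -> 0 < eta -> 16 * eta <= s ->
  K <= nn * eta -> `|ee - nn * s| < nn * eta -> 0 <= bM < K -> 0 <= bT < K ->
  0 < ee - bM /\ 0 <= (ee - bT) / (ee - bM) <= 1 + 2 * K / s / nn.
Proof.
move=> nn0 eta0 etas Kn; rewrite ltr_norml => /andP[el eu].
move=> /andP[bM0 bMK] /andP[bT0 bTK].
have s0 : 0 < s by lra.
have ne0 : 0 < nn * eta by exact: mulr_gt0.
have ns : 16 * (nn * eta) <= nn * s by rewrite mulrCA ler_wpM2l// ltW.
have rM : nn * s / 2 <= ee - bM by lra.
have rM0 : 0 < ee - bM by lra.
have K0 : 0 <= 2 * K / s / nn by rewrite !divr_ge0 ?(ltW nn0) ?(ltW s0)//; lra.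
split => //; rewrite divr_ge0 ?(ltW rM0)//=; last by lra.
rewrite ler_pdivrMr// mulrDl mul1r.
have : 2 * K / s / nn * (nn * s / 2) <= 2 * K / s / nn * (ee - bM).
  by rewrite ler_wpM2l.
have -> : 2 * K / s / nn * (nn * s / 2) = K by field; rewrite !gt_eqF.
lra.
Qed.

(** Of the [12 * eta] guaranteed by the limit, one is lost to the drift, two to the cross term, one
    to [ee] and one to [bM]. So the denominator is at least [nn * (s + 7 * eta)], while the
    numerator is at most [nn * (s + eta)]. *)
Lemma rss_ratio_not_nested (R : realType) (nn s eta K qM QM aM ee bM bT : R) :
  0 < nn -> 0 < eta -> 16 * eta <= s -> 12 * eta <= QM -> `|QM - qM| < eta ->
  K <= nn * eta -> `|ee - nn * s| < nn * eta -> `|aM| < nn * eta ->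
  0 <= bM < K -> 0 <= bT < K ->
  0 < nn * qM + 2 * aM + ee - bM /\
  0 <= (ee - bT) / (nn * qM + 2 * aM + ee - bM) <= (s + eta) / (s + 7 * eta).
Proof.
move=> nn0 eta0 etas etaQ; rewrite ltr_norml => /andP[_ qu] Kn.
rewrite !ltr_norml => /andP[el eu] /andP[al _] /andP[bM0 bMK] /andP[bT0 bTK].
have ne0 : 0 < nn * eta by exact: mulr_gt0.
have ns : 16 * (nn * eta) <= nn * s by rewrite mulrCA ler_wpM2l// ltW.
have nl : nn * (11 * eta) <= nn * qM by rewrite ler_wpM2l ?(ltW nn0)//; lra.
rewrite mulrCA in nl; set rM := nn * qM + _ + _ - _.
have rM7 : nn * s + 7 * (nn * eta) <= rM by rewrite /rM; lra.
have rM0 : 0 < rM by lra.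
split => //; rewrite divr_ge0 ?(ltW rM0)//=; last by lra.
rewrite ler_pdivrMr// mulrAC ler_pdivlMr; last by lra.
apply: (@le_trans _ _ (nn * (s + eta) * (s + 7 * eta))).
  by rewrite ler_wpM2r//; lra.
rewrite mulrAC mulrC ler_wpM2l//; lra.
Qed.

(** * Posterior ratio for well-behaved errors *)

Section good_event.
Context {R : realType} {p : nat} (X : forall n : nat, 'M[R]_(n, p.+1)).
Variables (T : {set 'I_p.+1}) (alpha : 'cV[R]_#|T|).
Hypothesis hX : forall n : nat, (p.+1 < n)%N -> design_matrix (X n).
Hypothesis hT : T \in models p.
Hypothesis hD : condition_D X alpha.
Implicit Types M N : {set 'I_p.+1}.

Definition mean n : 'cV[R]_n := submatrix (X n) T *m alpha.

(** The noncentrality of the residual sum of squares of [N], per observation. *)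
Definition drift n N : R :=
  qform (n%:R^-1 *: ((submatrix (X n) T)^T *m (1%:M - hat (X n) N)
                     *m submatrix (X n) T)) alpha.

Lemma dotc_res_mean n N : (p.+1 < n)%N ->
  dotc (res (X n) N *m mean n) (res (X n) N *m mean n) = n%:R * drift n N.
Proof.
move=> pn; have [rk _] := hX pn.
rewrite -qform_proj ?tr_res ?res_idem// /drift /qform.
rewrite -scalemxAr -scalemxAl [in RHS]mxE mulrA divff ?mul1r; last first.
  by rewrite pnatr_eq0 -lt0n (leq_ltn_trans _ pn).
by rewrite /mean /res trmx_mul !mulmxA.
Qed.

Lemma res_mean_sub n N : (p.+1 < n)%N -> T \subset N -> res (X n) N *m mean n = 0.
Proof.
move=> pn TN; have [rk _] := hX pn.
by rewrite /mean /res mulmxBl mul1mx mulmxA hat_submatrix_sub// subrr.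
Qed.

Lemma drift_cvg N : N \in models p -> exists Q : R,
  [/\ drift n N @[n --> \oo] --> Q, 0 <= Q
    & N != T -> ~~ (T \subset N) -> 0 < Q].
Proof.
move=> /hD[S [cS [_ S0] Spos]]; exists (qform S alpha); split => //.
have qE (A : 'M[R]_#|T|) : qform A alpha
    = \sum_i \sum_j alpha j 0 * A j i * alpha i 0.
  rewrite /qform mxE; apply: eq_bigr => i _; rewrite mxE mulr_suml.
  by apply: eq_bigr => j _; rewrite mxE.
rewrite /drift qE; under eq_fun do rewrite qE.
apply: cvg_sumr => i _; apply: cvg_sumr => j _.
apply: cvgMr_tmp; apply: cvgMl_tmp.
by apply: (cvg_comp _ (fun A : 'M[R]_#|T| => A j i) cS); exact: coord_continuous.
Qed.

(** A condition on a fixed error vector, so that the posterior ratio is bounded without probability.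
    The squared errors and the cross terms are controlled to order n, the projected errors to order
    1. *)
Definition good_event (s eta K : R) n (eps : 'cV[R]_n) : Prop :=
  `|dotc eps eps - n%:R * s| < n%:R * eta /\
  forall N, N \in models p ->
    `|dotc (res (X n) N *m mean n) eps| < n%:R * eta /\
    dotc (hat (X n) N *m eps) (hat (X n) N *m eps) < K.

Lemma null_in_models : null_model p \in models p.
Proof. by rewrite inE set11. Qed.

(** [eta] depends only on [s] and the limiting drift of [M], so [K] can be chosen afterwards
    according to the probability to be tolerated. The rank of n from which the bound holds is the
    same for all error vectors. *)
Lemma posterior_ratio_good (s : R) M : 0 < s -> M \in models p -> M != T ->
  exists2 eta : R, 0 < eta & forall K e : R, 0 <= K -> 0 < e ->
    \forall n \near \oo, forall eps : 'cV[R]_n, good_event s eta K eps ->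
    `|posterior (X n) (mean n + eps) M / posterior (X n) (mean n + eps) T| <= e.
Proof.
move=> s0 hM MT.
have [Q1 [cQ1 Q1ge0 _]] := drift_cvg null_in_models.
have [QM [cQM QMge0 QMgt0]] := drift_cvg hM.
have [eta [eta0 etas etaQ]] : exists eta : R, [/\ 0 < eta, 16 * eta <= s
    & ~~ (T \subset M) -> 12 * eta <= QM].
  have [TM|nTM] := boolP (T \subset M).
    by exists (s / 16); split => //; lra.
  have QM0 := QMgt0 MT nTM.
  exists (Num.min (s / 16) (QM / 12)).
  split => [||_]; first by rewrite lt_min !divr_gt0.
    by rewrite -ler_pdivlMl// [leRHS]mulrC ge_min lexx.
  by rewrite -ler_pdivlMl// [leRHS]mulrC ge_min lexx orbT.
exists eta => // K e K0 e0.
have s2 : 0 < s - 2 * eta by lra.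
(* The lower bound that [rss_bounds] provides for the ratio of [T] to the null model. *)
pose delta := (s - 2 * eta) / (Q1 + s + 4 * eta).
have d0 : 0 < delta by rewrite divr_gt0//; lra.
pose C := bf_ub_const #|M| / bf_lb_const #|T| delta.
have C0 : 0 <= C.
  by rewrite divr_ge0 ?(ltW (bf_lb_const_gt0 _ _))// mulr_ge0 ?powR_ge0 ?expR_ge0.
pose rho := (s + eta) / (s + 7 * eta).
have rho01 : 0 < rho < 1.
  by rewrite divr_gt0 ?ltr_pdivrMr; lra.
pose bound n := if T \subset M then 1 + 2 * K / s / n%:R else rho.
have decay : \forall n \near \oo, forall x : R, 0 <= x <= bound n ->
    C * (n%:R `^ ((#|T|%:R - #|M|%:R) / 2) * x `^ ((n%:R - 1) / 2)) <= e.
  rewrite /bound; have [TM|nTM] := boolP (T \subset M).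
    apply: near_poly_decay => //; last by rewrite divr_ge0 ?mulr_ge0// ltW.
    by apply: proper_card; rewrite finset.properEneq eq_sym MT.
  near=> n => x /andP[x0 xr].
  have n1 : (0 < n)%N by near: n; exact: nbhs_infty_gt.
  (* The exponent of n may be positive here; the crude bound [#|T|] suffices against exponential
     decay. *)
  apply: (@le_trans _ _ (C * (n%:R ^+ #|T| * rho `^ ((n%:R - 1) / 2)))).
    rewrite ler_wpM2l// ler_pM ?powR_ge0//; last first.
      by apply: powR_le => //; rewrite divr_ge0// subr_ge0 ler1n.
    rewrite -powR_mulrn//; apply: ler_powR; first by rewrite ler1n.
    have := ler0n R #|T|; have := ler0n R #|M|; lra.
  by near: n; exact: near_exp_decay.
have /cvgrPdist_lt/(_ _ eta0) nearQ1 := cQ1.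
have /cvgrPdist_lt/(_ _ eta0) nearQM := cQM.
near=> n => eps [he hN].
have pn : (p.+1 < n)%N by near: n; exact: nbhs_infty_gt.
have nn0 : 0 < n%:R :> R by rewrite ltr0n (leq_ltn_trans _ pn).
have Kn : K <= n%:R * eta.
  by rewrite -ler_pdivrMr//; near: n; exact: nbhs_infty_ger.
have q1 : `|Q1 - drift n (null_model p)| < eta.
  by near: n; exact: nearQ1.
have qM : `|QM - drift n M| < eta.
  by near: n; exact: nearQM.
have fin : forall x : R, 0 <= x <= bound n ->
    C * (n%:R `^ ((#|T|%:R - #|M|%:R) / 2) * x `^ ((n%:R - 1) / 2)) <= e.
  by near: n.
have [rk _] := hX pn.
have [c1 b1] := hN _ null_in_models.
have [cM bM] := hN _ hM.
have [_ bT] := hN _ hT.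
have rE N : qform (1%:M - hat (X n) N) (mean n + eps) = n%:R * drift n N
    + 2 * dotc (res (X n) N *m mean n) eps + dotc eps eps
    - dotc (hat (X n) N *m eps) (hat (X n) N *m eps).
  by rewrite -dotc_res_mean// -qform_res_decomp.
have dot0 (v : 'cV[R]_n) : dotc 0 v = 0.
  by rewrite /dotc big1// => i _; rewrite mxE mul0r.
have sub0 N : T \subset N -> qform (1%:M - hat (X n) N) (mean n + eps) =
    dotc eps eps - dotc (hat (X n) N *m eps) (hat (X n) N *m eps).
  by move=> TN; rewrite rE -dotc_res_mean// res_mean_sub// !dot0 mulr0 !add0r.
have hb N : N \in models p -> 0 <= dotc (hat (X n) N *m eps) (hat (X n) N *m eps) < K.
  by move=> /hN[_ ->]; rewrite dotc_ge0.
have [r1 /andP[rTl rTu] dT] := rss_bounds nn0 eta0 etas Q1ge0 q1 Kn he c1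
  (hb _ null_in_models) (hb _ hT).
rewrite -rE -sub0// in r1 rTl rTu dT.
have rT : 0 < qform (1%:M - hat (X n) T) (mean n + eps).
  by apply: lt_le_trans rTl; exact: mulr_gt0.
have [rM /fin ratio] : 0 < qform (1%:M - hat (X n) M) (mean n + eps) /\
  0 <= qform (1%:M - hat (X n) T) (mean n + eps)
       / qform (1%:M - hat (X n) M) (mean n + eps) <= bound n.
  rewrite /bound (sub0 T (subxx _)); have [TM|nTM] := boolP (T \subset M).
    by rewrite sub0//; apply: (rss_ratio_nested nn0 eta0 etas Kn he); exact: hb.
  rewrite rE; apply: (rss_ratio_not_nested nn0 eta0 etas (etaQ nTM) qM Kn he cM);
    exact: hb.
apply: le_trans ratio; apply: posterior_ratio_le => //.
by rewrite d0.
Unshelve. all: by end_near. Qed.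

End good_event.

(** * Probability of large deviations *)

Section ge0_mean.
Context {R : realType} {d : measure_display} {Omega : measurableType d}.
Variable P : probability Omega R.

(** Bundles what Markov's inequality requires in a form stable under sums and nonnegative
    scaling. *)
Definition ge0_mean (f : Omega -> R) (e : R) : Prop :=
  [/\ measurable_fun setT f, forall w, 0 <= f w & (\int[P]_w (f w)%:E = e%:E)%E].

Lemma ge0_meanD f g a b : ge0_mean f a -> ge0_mean g b ->
  ge0_mean (fun w => f w + g w) (a + b).
Proof.
move=> [mf f0 fa] [mg g0 gb]; split; first exact: measurable_funD.
  by move=> w; rewrite addr_ge0.
under eq_integral do rewrite EFinD.
rewrite ge0_integralD//= ?fa ?gb//; try exact/measurable_EFinP.
- by move=> w _; rewrite lee_fin.
- by move=> w _; rewrite lee_fin.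
Qed.

Lemma ge0_meanZ f a c : 0 <= c -> ge0_mean f a ->
  ge0_mean (fun w => c * f w) (c * a).
Proof.
move=> c0 [mf f0 fa]; split; first exact: measurable_funM.
  by move=> w; rewrite mulr_ge0.
under eq_integral do rewrite EFinM.
rewrite ge0_integralZl//= ?fa//; first exact/measurable_EFinP.
by move=> w _; rewrite lee_fin.
Qed.

Lemma ge0_mean_sum (I : Type) (r : seq I) (A : pred I) f a :
  (forall i, A i -> ge0_mean (f i) (a i)) ->
  ge0_mean (fun w => \sum_(i <- r | A i) f i w) (\sum_(i <- r | A i) a i).
Proof.
move=> fa; elim: r => [|i r ih].
  rewrite big_nil; under eq_fun do rewrite big_nil.
  by split => //; rewrite integral0.
rewrite big_cons; under eq_fun do rewrite big_cons.
by case: ifPn => // Ai; apply: ge0_meanD => //; exact: fa.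
Qed.

End ge0_mean.

Lemma normal_moments (R : realType) (sigma : R) : 0 < sigma ->
  exists s kappa : R, [/\ 0 < s,
    (\int[normal_prob 0 sigma]_x x%:E = 0)%E,
    (\int[normal_prob 0 sigma]_x (x ^+ 2)%:E = s%:E)%E,
    (\int[normal_prob 0 sigma]_x (x ^+ 2 - s)%:E = 0)%E
    & (\int[normal_prob 0 sigma]_x ((x ^+ 2 - s) ^+ 2)%:E = kappa%:E)%E].
Proof.
move=> sigma0; have i4 := normal_fourth_moment sigma0.
pose nu : probability (measurableTypeR R) R := normal_prob 0 sigma.
rewrite -[normal_prob 0 sigma]/(nu : set _ -> _) in i4 *.
have i0 : nu.-integrable setT (cst 1%E).
  exact: (finite_measure_integrable_cst nu 1 measurableT).
have mX k : measurable_fun [set: measurableTypeR R] (fun x : R => (x ^+ k)%:E).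
  by apply/measurable_EFinP; exact: exprn_measurable.
have i04 := integrableD measurableT i0 i4.
(* All lower powers are dominated by [1 + x ^+ 4]. *)
have dom k : (k <= 4)%N -> nu.-integrable setT (fun x : R => (x ^+ k)%:E).
  move=> k4; apply: le_integrable i04 => // x _ /=.
  have x4 : 0 <= x ^+ 4 by exact: exprn_even_ge0.
  rewrite lee_fin [leRHS]ger0_norm ?addr_ge0// normrX.
  have -> : x ^+ 4 = `|x| ^+ 4 by rewrite -normrX ger0_norm.
  have [x1|x1] := leP `|x| 1.
    by rewrite (le_trans (exprn_ile1 _ (normr_ge0 x) x1))// lerDl exprn_ge0.
  by rewrite (le_trans (ler_weXn2l (ltW x1) k4))// lerDr.
have i2 := dom 2 isT.
pose s := fine (\int[nu]_x (x ^+ 2)%:E)%E.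
have sE : (\int[nu]_x (x ^+ 2)%:E = s%:E)%E.
  by rewrite /s fineK//; exact: integrable_fin_num.
have s_ge0 : 0 <= s.
  by rewrite -lee_fin -sE integral_ge0// => x _; rewrite lee_fin sqr_ge0.
have ic : nu.-integrable setT (cst s%:E).
  exact: (finite_measure_integrable_cst nu s measurableT).
have i2s : nu.-integrable setT (fun x : R => (x ^+ 2 - s)%:E).
  by have := integrableB measurableT i2 ic.
have is2 : nu.-integrable setT (fun x : R => ((x ^+ 2 - s) ^+ 2)%:E).
  have i4' := integrableZl measurableT (-2 * s) i2.
  have ic2 : nu.-integrable setT (cst (s ^+ 2)%:E).
    exact: (finite_measure_integrable_cst nu (s ^+ 2) measurableT).
  have := integrableD measurableT (integrableD measurableT i4 i4') ic2.
  apply: eq_integrable => // x _ /=; rewrite -EFinM -!EFinD; congr _%:E.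
  by rewrite /=; ring.
exists s, (fine (\int[nu]_x ((x ^+ 2 - s) ^+ 2)%:E)%E); split => //.
(* If the second moment were 0, the law would be concentrated at 0, which is a null set by absolute
   continuity. *)
- rewrite lt_neqAle s_ge0 andbT eq_sym; apply/eqP => s0.
  have : (\int[nu]_x `|(x ^+ 2)%:E| = 0)%E.
    transitivity s%:E; last by rewrite s0.
    rewrite -sE; apply: eq_integral => x _.
    by rewrite gee0_abs// lee_fin sqr_ge0.
  move=> /(ae_eq_integral_abs nu measurableT (mX 2))[A [mA nuA0 subA]].
  have nu00 : nu [set 0] = 0%E.
    move/null_content_dominatesP: (normal_prob_dominates 0 sigma); apply => //.
    exact: lebesgue_measure_set1.
  have : nu setT = 1%E by exact: probability_setT.
  have -> : [set: measurableTypeR R] = A `|` [set 0].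
    apply/seteqP; split => // x _; have [->|x0] := eqVneq x 0; [by right|left].
    apply: subA => /= /(_ I) [] /eqP; rewrite expf_eq0/= => /eqP x00.
    by rewrite x00 eqxx in x0.
  move=> nuU; have : (1%E <= nu A + nu [set 0%R])%E.
    by rewrite -[leLHS]nuU; exact: (measureU2 nu mA (measurable_set1 0)).
  by rewrite nuA0 nu00 adde0 leNgt lte01.
- by apply: normal_mean0 => //; exact: (dom 1).
- transitivity (\int[nu]_x ((x ^+ 2)%:E - s%:E))%E; first by [].
  rewrite integralB// sE integral_cst// [X in (_ - _ * X)%E](_ : _ = 1%E).
    by rewrite mule1 -EFinB subrr.
  exact: probability_setT.
- by rewrite fineK//; exact: integrable_fin_num.
Qed.

Section bad_event.
Context {R : realType} {p : nat} (X : forall n : nat, 'M[R]_(n, p.+1)).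
Variables (T : {set 'I_p.+1}) (alpha : 'cV[R]_#|T|) (sigma : R).
Hypothesis hX : forall n : nat, (p.+1 < n)%N -> design_matrix (X n).
Hypothesis sigma0 : 0 < sigma.
Context {n : nat} {d : measure_display} {Omega : measurableType d}
  (P : probability Omega R) (y : 'I_n -> {RV P >-> R}).
Hypothesis pn : (p.+1 < n)%N.
Hypothesis hy : spherical_normal y (mean X alpha n) sigma.

Let nu : probability (measurableTypeR R) R := normal_prob 0 sigma.
Let Z i (w : Omega) : measurableTypeR R := y i w - mean X alpha n i 0.

Let mZ i : measurable_fun setT (Z i).
Proof. by apply: (measurable_funB (f := y i)). Qed.

Lemma centred_sample_iid (B : 'I_n -> set R) : (forall i, measurable (B i)) ->
  P [set w | forall i, B i (Z i w)] = (\prod_(i < n) nu (B i))%E.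
Proof.
move=> mB; have mB' i : measurable ((fun x => x - mean X alpha n i 0) @^-1` B i).
  rewrite -[X in measurable X]setTI.
  by apply: (measurable_funB (f := id)).
rewrite [LHS](hy mB'); apply: eq_bigr => i _.
exact: normal_prob_center.
Qed.

Definition noise w : 'cV[R]_n := \col_i (y i w - mean X alpha n i 0).

Lemma sampleE w : sample y w = mean X alpha n + noise w.
Proof. by apply/colP => i; rewrite !mxE addrC subrK. Qed.

(** [W] adds up the squared deviations, scaled so that violating any clause of [good_event] makes
    [W >= 1]; Markov's inequality then applies. Taking a measurable [A] disjoint from the good event
    spares the measurability of that event. *)
Lemma good_event_prob (s kappa eta K : R) (A : set Omega) :
  (\int[nu]_x x%:E = 0)%E -> (\int[nu]_x (x ^+ 2)%:E = s%:E)%E ->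
  (\int[nu]_x (x ^+ 2 - s)%:E = 0)%E ->
  (\int[nu]_x ((x ^+ 2 - s) ^+ 2)%:E = kappa%:E)%E ->
  0 < eta -> 0 < K -> measurable A ->
  (forall w, good_event X alpha s eta K (noise w) -> ~ A w) ->
  (P A <= (n%:R^-1 * (eta ^- 2 * (kappa + s * \sum_(N in models p) drift X alpha n N))
           + (s * \sum_(N in models p) #|N|%:R) / K)%:E)%E.
Proof.
move=> m1 m2 m3 m4 eta0 K0 mA goodA.
have nn0 : 0 < n%:R :> R by rewrite ltr0n (leq_ltn_trans _ pn).
have [rk _] := hX pn.
pose c := (n%:R * eta) ^- 2.
have c0 : 0 < c by rewrite invr_gt0 exprn_gt0// mulr_gt0.
have mean_lin (f : measurableTypeR R -> R) v (a : 'I_n -> R) :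
    measurable_fun setT f -> (\int[nu]_x (f x)%:E = 0)%E ->
    (\int[nu]_x (f x ^+ 2)%:E = v%:E)%E ->
    ge0_mean P (fun w => (\sum_i a i * f (Z i w)) ^+ 2) (v * \sum_i a i ^+ 2).
  move=> mf f0 f2; split.
  - apply: measurable_funX; apply: measurable_sum => i; apply: measurable_funM => //.
    exact: (measurableT_comp mf (mZ i)).
  - by move=> w; exact: sqr_ge0.
  - exact: (iid_second_moment mZ centred_sample_iid a mf f0 f2).
have mid : measurable_fun [set: measurableTypeR R] (fun x => x : R) by [].
have lin a := mean_lin _ s a mid m1 m2.
have msq : measurable_fun [set: measurableTypeR R] (fun x => x ^+ 2 - s : R).
  by apply: measurable_funB => //; exact: exprn_measurable.
have W0 := mean_lin _ kappa (fun=> 1) msq m3 m4.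
pose cN N i := (res (X n) N *m mean X alpha n) i 0.
have W1 N := ge0_meanZ (ltW c0) (lin (cN N)).
have Ki0 : 0 < K^-1 by rewrite invr_gt0.
have W2 N : ge0_mean P (fun w => K^-1 * \sum_k (\sum_i hat (X n) N k i * Z i w) ^+ 2)
    (K^-1 * \sum_k (s * \sum_i hat (X n) N k i ^+ 2)).
  by apply: ge0_meanZ (ltW Ki0) _; apply: ge0_mean_sum => k _; exact: lin.
pose W w : R := c * (\sum_i 1 * (Z i w ^+ 2 - s)) ^+ 2
  + \sum_(N in models p) (c * (\sum_i cN N i * Z i w) ^+ 2
       + K^-1 * \sum_k (\sum_i hat (X n) N k i * Z i w) ^+ 2).
pose eW : R := c * (kappa * \sum_(i < n) 1 ^+ 2)
  + \sum_(N in models p) (c * (s * \sum_i cN N i ^+ 2)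
       + K^-1 * \sum_k (s * \sum_i hat (X n) N k i ^+ 2)).
have [mW W_ge0 EW] : ge0_mean P W eW.
  apply: ge0_meanD; first exact: ge0_meanZ (ltW c0) W0.
  by apply: ge0_mean_sum => N _; exact: ge0_meanD (W1 N) (W2 N).
have := markov_ge0 mW W_ge0 ltr01 EW.
rewrite invr1 mul1r => PW.
have AW : A `<=` [set w | 1 <= W w].
  move=> w Aw /=; rewrite leNgt; apply/negP => W1lt.
  have small x : c * x ^+ 2 < 1 -> `|x| < n%:R * eta.
    rewrite /c mulrC ltr_pdivrMr ?exprn_gt0 ?mulr_gt0// mul1r.
    rewrite -real_normK ?num_real// ltr_sqr ?nnegrE//.
    by rewrite mulr_ge0 ?(ltW nn0) ?(ltW eta0).
  have t0 (N : {set 'I_p.+1}) : 0 <= c * (\sum_i cN N i * Z i w) ^+ 2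
       + K^-1 * \sum_k (\sum_i hat (X n) N k i * Z i w) ^+ 2.
    by have [_ /(_ w)] := ge0_meanD (W1 N) (W2 N).
  have s00 : 0 <= c * (\sum_i 1 * (Z i w ^+ 2 - s)) ^+ 2.
    by rewrite mulr_ge0 ?sqr_ge0// ltW.
  apply: (goodA w) => //; split.
    have -> : dotc (noise w) (noise w) - n%:R * s = \sum_i 1 * (Z i w ^+ 2 - s).
      under eq_bigr do rewrite mul1r.
      rewrite sumrB sumr_const card_ord mulr_natl; congr (_ - _).
      by apply: eq_bigr => i _; rewrite mxE expr2.
    apply: small; apply: le_lt_trans W1lt.
    by rewrite lerDl sumr_ge0.
  move=> N hN; have : c * (\sum_i cN N i * Z i w) ^+ 2
       + K^-1 * \sum_k (\sum_i hat (X n) N k i * Z i w) ^+ 2 < 1.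
    apply: le_lt_trans W1lt; rewrite /W (bigD1 N)//= addrCA lerDl.
    by rewrite addr_ge0// sumr_ge0.
  have [_ /(_ w) /= a0 _] := W1 N; have [_ /(_ w) /= b0 _] := W2 N.
  move=> ab; split.
    have -> : dotc (res (X n) N *m mean X alpha n) (noise w)
       = \sum_i cN N i * Z i w.
      by apply: eq_bigr => i _; rewrite [in X in _ * X]mxE.
    by apply: small; apply: le_lt_trans ab; rewrite lerDl.
  have -> : dotc (hat (X n) N *m noise w) (hat (X n) N *m noise w)
     = \sum_k (\sum_i hat (X n) N k i * Z i w) ^+ 2.
    apply: eq_bigr => k _; rewrite expr2 mxE.
    by under eq_bigr do rewrite [noise w _ _]mxE.
  rewrite -[K]mulr1 -ltr_pdivrMl//; apply: le_lt_trans ab; rewrite lerDr//.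
have mW1 : measurable [set w | 1 <= W w].
  rewrite [X in measurable X](_ : _ = setT `&` W @^-1` `[1, +oo[); last first.
    by rewrite setTI; apply/seteqP; split=> w /=; rewrite in_itv/= andbT.
  by apply: mW => //; exact: measurable_itv.
apply: le_trans (le_trans (le_measure P _ _ AW) PW) _; rewrite ?inE//.
(* The bound is exactly the mean of [W]: the terms scaled by [c] have second moments linear in n,
   which leaves 1/n, and the projections contribute [s * #|N| / K]. *)
rewrite lee_fin le_eqVlt; apply/orP; left; apply/eqP; rewrite /eW.
have -> : \sum_(i < n) 1 ^+ 2 = n%:R :> R.
  by under eq_bigr do rewrite expr1n; rewrite sumr_const card_ord.
have E1 N : \sum_i cN N i ^+ 2 = n%:R * drift X alpha n N.
  by rewrite -dotc_res_mean//; apply: eq_bigr => i _; rewrite expr2.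
have E2 N : \sum_k (s * \sum_i hat (X n) N k i ^+ 2) = s * #|N|%:R.
  by rewrite -mulr_sumr sum_sqr_hat.
under eq_bigr do rewrite E1 E2.
rewrite big_split/= -!mulr_sumr addrA; congr (_ + _); last first.
  by rewrite mulrC.
rewrite /c; move: (\sum_(N in _) drift _ _ _ _) => D.
by field; rewrite !gt_eqF.
Qed.

End bad_event.

(* Convergence in probability of the posterior ratio *)
Local Close Scope classical_set_scope.

Theorem theorem4 (R : realType) (p : nat)
  (X : forall n : nat, 'M[R]_(n, p.+1))
  (hX : forall n : nat, (p.+1 < n)%N -> design_matrix (X n))
  (T : {set 'I_p.+1}) (hT : T \in models p)
  (alpha : 'cV[R]_#|T|) (sigma : R) (hsigma : 0 < sigma)
  (d : nat -> measure_display) (Omega : forall n : nat, measurableType (d n))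
  (P : forall n : nat, probability (Omega n) R)
  (y : forall n : nat, 'I_n -> {RV (P n) >-> R})
  (hy : forall n : nat, (p.+1 < n)%N ->
     spherical_normal (y n) (submatrix (X n) T *m alpha) sigma)
  (hD : condition_D X alpha) :
  forall M : {set 'I_p.+1}, M \in models p -> M != T ->
    cvg_in_probability P
      (fun n (w : Omega n) =>
         posterior (X n) (sample (y n) w) M / posterior (X n) (sample (y n) w) T)
      0.
Proof.
move=> M hM MT eps eps0.
have [s [kappa [s0 m1 m2 m3 m4]]] := normal_moments hsigma.
have [eta eta0 small] := posterior_ratio_good hX hT hD s0 hM MT.
pose Zn n w := posterior (X n) (sample (y n) w) M / posterior (X n) (sample (y n) w) T.
pose A n := [set w : Omega n | eps < `|Zn n w - 0|]%classic.
have mA n : measurable (A n).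
  have mZ : measurable_fun setT (fun w => `|Zn n w - 0|).
    apply: measurableT_comp => //; apply: measurable_funB => //.
    apply: measurable_funM; first exact: measurable_posterior.
    by apply: measurable_funV => //; exact: measurable_posterior.
  rewrite [X in measurable X](_ : _ =
    setT `&` (fun w => `|Zn n w - 0|) @^-1` `]eps, +oo[)%classic; last first.
    by rewrite setTI; apply/seteqP; split=> w /=; rewrite in_itv/= andbT.
  by apply: mZ => //; exact: measurable_itv.
pose D : R := \sum_(N in models p) #|N|%:R.
have D0 : 0 <= D by rewrite sumr_ge0.
pose g n : R := n%:R^-1 *
  (eta ^- 2 * (kappa + s * \sum_(N in models p) drift X alpha n N)).
have g0 : (g n @[n --> \oo] --> (0:R))%classic.
  (* [drift_cvg] yields a limit for each model separately; [lim] turns these into a function of [N].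
     The drifts converge, so the factor 1/n sends [g] to 0. *)
  pose Q N : R := lim (drift X alpha n N @[n --> \oo])%classic.
  have cQ : (\sum_(N in models p) drift X alpha n N @[n --> \oo]
      --> \sum_(N in models p) Q N)%classic.
    apply: cvg_sumr => N /(drift_cvg hD)[q [cq _ _]].
    by rewrite /Q (cvg_lim _ cq).
  have -> : 0 = 0 * (eta ^- 2 * (kappa + s * \sum_(N in models p) Q N)).
    by rewrite mul0r.
  apply: cvgM.
    apply/cvgrPdist_lt => e e0; near=> n.
    have en : e^-1 < n%:R by near: n; exact: nbhs_infty_gtr.
    have n0 : 0 < n%:R :> R by apply: lt_trans en; rewrite invr_gt0.
    by rewrite sub0r normrN ger0_norm ?invr_ge0// invf_plt.
  by apply: cvgMl_tmp; apply: cvgD; [exact: cvg_cst|exact: cvgMl_tmp].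
apply/fine_cvgP; split.
  by apply: nearW => n; exact: fin_num_measure.
apply/cvgrPdist_le => tol tol0.
(* Chosen so that [s * D / K <= tol / 2]; the added 1 keeps [K] positive. *)
pose K := 2 * (s * D + 1) / tol.
have K0 : 0 < K by rewrite divr_gt0// mulr_gt0// ltr_wpDl// mulr_ge0// ltW.
have tol2 : 0 < tol / 2 by rewrite divr_gt0.
near=> n.
have pn : (p.+1 < n)%N by near: n; exact: nbhs_infty_gt.
have gn : `|0 - g n| < tol / 2.
  by near: n; move/cvgrPdist_lt: g0 => /(_ _ tol2).
have goodn : forall e : 'cV[R]_n, good_event X alpha s eta K e ->
    `|posterior (X n) (mean X alpha n + e) M / posterior (X n) (mean X alpha n + e) T|
    <= eps.
  by near: n; apply: small => //; exact: ltW.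
have bound : (P n (A n) <= (g n + s * D / K)%:E)%E.
  have H := good_event_prob hX hsigma pn (hy _ pn) m1 m2 m3 m4 eta0 K0 (mA n).
  apply: H.
  move=> w /goodn; rewrite -sampleE /A/= subr0 => le_eps.
  by apply/negP; rewrite -leNgt.
rewrite sub0r normrN ger0_norm ?fine_ge0// -lee_fin fineK ?fin_num_measure//.
apply: le_trans bound _; rewrite lee_fin.
move: gn; rewrite sub0r normrN => /ltW /ler_normlW gn.
have : s * D / K <= tol / 2.
  rewrite ler_pdivrMr// /K.
  have -> : tol / 2 * (2 * (s * D + 1) / tol) = s * D + 1.
    by field; rewrite gt_eqF.
  by rewrite lerDl.
lra.
Unshelve. all: by end_near. Qed.
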